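(* Let a network $P$, a consensus matrix $N$ and a class $\mathcal{O}_{m,L}$ be given such that Assumptions 1–4 below hold, let $K$ be a controller such that $P\star K$ is well-posed (with closed-loop matrices $(\mathcal{A},\mathcal{B},\mathcal{C},\mathcal{D})$), let $\rho\in(0,1)$ and let $\nu_{\max}\in\mathbb{N}$. Suppose that all of the following hold: 1. (Information Constraint) $\mathcal{D}$ is block-lower-triangular with respect to the partition into $c\times c$ blocks. 2. (Regulator Equations) There exist matrices $(\Pi,\Theta,\Gamma,\Phi)$ with $A\Pi+(0\ \ B_1N)+B_2\Gamma=\Pi$, $C_1\Pi+(\mathbf{1}_s\otimes I_c\ \ D_1N)+D_{12}\Gamma=0$, $C_2\Pi+(0\ \ D_{21}N)+D_2\Gamma=\Phi$, $A_c\Theta+B_c\Phi=\Theta$, $C_c\Theta+D_c\Phi=\Gamma$. 3. (Robust Stability) $I-\mathbf{m}\mathcal{D}$ is invertible and, with $(\hat{\mathcal{A}},\hat{\mathcal{B}},\hat{\mathcal{C}}(\lambda),\hat{\mathcal{D}}(\lambda))$ denoting the realization of the filtered interconnection $G^\Psi(\lambda)$ defined below, there exist a symmetric matrix $\mathcal{M}\succ0$ and coefficients $\lambda=(\lambda^i_\nu)_{1\le i\le s,\,0\le\nu\le\nu_{\max}}$ with $$\begin{pmatrix} \hat{\mathcal{A}} & \hat{\mathcal{B}} \\ I & 0 \end{pmatrix}^\top \begin{pmatrix} \mathcal{M} & 0 \\ 0 & -\mathcal{M} \end{pmatrix} \begin{pmatrix} \hat{\mathcal{A}} & \hat{\mathcal{B}}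 \\ I & 0 \end{pmatrix} + \frac12 \begin{pmatrix} \hat{\mathcal{C}}(\lambda) & \hat{\mathcal{D}}(\lambda) \\ 0 & I \end{pmatrix}^\top \begin{pmatrix} 0 & I \\ I & 0 \end{pmatrix} \begin{pmatrix} \hat{\mathcal{C}}(\lambda) & \hat{\mathcal{D}}(\lambda) \\ 0 & I \end{pmatrix} \prec 0,$$ $$\sum_{\nu=0}^{\nu_{\max}}\rho^{-\nu}\lambda^i_\nu>0,\qquad \lambda^i_\nu\le0\ \ \forall\nu\ge1,\qquad\forall i\in\{1,\dots,s\}.$$ Then the interconnection of $F$ and $P\star K$ is well-posed and $\rho$-exponentially convergent for all $F\in\mathcal{O}_{m,L}$.
   Context: Function classes. Let $\mathbf{q}(x)=\frac12\|x\|^2$ on $\mathbb{R}^c$. For $m\in\mathbb{R}$, $L\in(m,\infty]$, $\mathcal{S}_{m,L}$ is the class of $f:\mathbb{R}^c\to\mathbb{R}\cup\{\pm\infty\}$ such that $f-m\mathbf{q}$ is proper, convex and closed (p.c.c.) and, if $L<\infty$, also $L\mathbf{q}-f$ is p.c.c.; $\partial f:=\partial(f-m\mathbf{q})+mI$ with the convex subdifferential on the right. Fix $s,c\ge1$ and $m=(m_1,\dots,m_s)$, $L=(L_1,\dots,L_s)$ with $m_i\in\mathbb{R}$, $L_i\in(m_i,\infty]$, $\sum_i m_i>0$. $\mathcal{O}_{m,L}$ is the class of operators $F:\mathbb{R}^{sc}\rightrightarrows\mathbb{R}^{sc}$, $F(z)=\partial f_1(z^1)\times\cdots\times\partial f_s(z^s)$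 with $f_i\in\mathcal{S}_{m_i,L_i}$, for which there is a unique pair $(\beta^*,w^* )\in\mathbb{R}^c\times\mathbb{R}^{sc}$ with $\sum_i w_i^*=0$, $w_i^*\in\partial f_i(\beta^* )$ for all $i$. Consensus matrix: $N\in\mathbb{R}^{sc\times(s-1)c}$ with $\mathrm{rank}(N)=(s-1)c$ and $\mathrm{ran}(N)=\mathrm{null}((\mathbf{1}_s\otimes I_c)^\top)$ (empty if $s=1$). Interconnection. The network $P$ is $x^N_{k+1}=Ax^N_k+B_1w_k+B_2u_k$, $z_k=C_1x^N_k+D_1w_k+D_{12}u_k$, $y_k=C_2x^N_k+D_{21}w_k+D_2u_k$ with $w_k,z_k\in\mathbb{R}^{sc}$; the controller $K$ is $\xi_{k+1}=A_c\xi_k+B_cy_k$, $u_k=C_c\xi_k+D_cy_k$. $P\star K$ is well-posed if $I-D_2D_c$ is invertible; eliminating $(u,y)$ gives $x_{k+1}=\mathcal{A}x_k+\mathcal{B}w_k$, $z_k=\mathcal{C}x_k+\mathcal{D}w_k$ with $x_k=(x^N_k,\xi_k)$. The algorithm $F\star(P\star K)$ is this system together with $w_k\in F(z_k)$; it is well-posed if $(F^{-1}-\mathcal{D})^{-1}$ is globally continuous (exactly one value at every point, and continuous), where $F^{-1}(x)=\{y\mid x\in F(y)\}$. It is convergent if there is a fixed point $(x^*,z^*,w^* )$, i.e. $x^*=\mathcal{A}x^*+\mathcal{B}w^*$, $z^*=\mathcal{C}x^*+\mathcal{D}w^*$, $w^*\in F(z^* )$, with $z^*=\mathbf{1}_s\otimes\beta^*$,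 $(\mathbf{1}_s\otimes I_c)^\top w^*=0$ and $\lim_k(x_k,w_k,z_k)=(x^*,w^*,z^* )$ for all $x_0$. It is $\rho$-exponentially convergent for all $F\in\mathcal{O}_{m,L}$ if it is convergent for all such $F$ and there is $\gamma>0$ such that for all $x_0$, all $F\in\mathcal{O}_{m,L}$ and all $k\in\mathbb{N}$: $\max\{\|x_k-x^*\|_2,\|w_k-w^*\|_2,\|z_k-z^*\|_2\}\le\gamma\rho^k\|x_0-x^*\|_2$. Assumptions. Put $\mathbf{m}:=\mathrm{diag}(m)\otimes I_c$. Assumption 1: $E(\mathbf{m}):=I-D_1\mathbf{m}$ is invertible. With $W:=\mathbf{m}E(\mathbf{m})^{-1}$ set $A^{\mathbf m}=A+B_1WC_1$, $B_2^{\mathbf m}=B_2+B_1WD_{12}$, $C_2^{\mathbf m}=C_2+D_{21}WC_1$, $B_1^{\mathbf m}=(0\ \ B_1N)+B_1W(\mathbf{1}_s\otimes I_c\ \ D_1N)$, $D_{21}^{\mathbf m}=(0\ \ D_{21}N)+D_{21}W(\mathbf{1}_s\otimes I_c\ \ D_1N)$. Assumption 2: $(A^{\mathbf m},B_2^{\mathbf m})$ is stabilizable and $(A^{\mathbf m},C_2^{\mathbf m})$ is detectable. Assumption 3: $\begin{pmatrix} A-I & B_2 \\ C_1 & D_{12} \end{pmatrix}$ has full column rank. Assumption 4: the pair $\left(\begin{pmatrix} A^{\mathbf m} & B_1^{\mathbf m} \\ 0 & I_{cs} \end{pmatrix},\ (C_2^{\mathbf m}\ \ D_{21}^{\mathbf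 m})\right)$ is detectable. (Discrete-time notions.) Filtered interconnection. Let $\boldsymbol{\sigma}:=\mathrm{diag}((L_1-m_1)^{-1},\dots,(L_s-m_s)^{-1})\otimes I_c$ (entry $0$ if $L_i=\infty$). $G^\Psi(\lambda)=\Psi(\lambda)(\Sigma_{m,L}\star\bar G)$ is the system with input $\bar q$ and output $\bar r$ obtained from $\bar x_{k+1}=\rho^{-1}\mathcal{A}\bar x_k+\rho^{-1}\mathcal{B}\bar w_k$, $\bar z_k=\mathcal{C}\bar x_k+\mathcal{D}\bar w_k$, $\bar p_k=-\boldsymbol{\sigma}\bar q_k+\bar z_k$, $\bar w_k=\bar q_k+\mathbf{m}\bar z_k$ (eliminating $\bar w,\bar z$, possible if $I-\mathbf{m}\mathcal{D}$ is invertible), followed by the filters $\bar r^i_k=\sum_{\nu=0}^{\nu_{\max}}\lambda^i_\nu\bar p^i_{k-\nu}$, $i=1,\dots,s$, realized by shift registers storing $(\bar p^i_{k-1},\dots,\bar p^i_{k-\nu_{\max}})$ with zero initial state. Its realization $(\hat{\mathcal{A}},\hat{\mathcal{B}},\hat{\mathcal{C}}(\lambda),\hat{\mathcal{D}}(\lambda))$ has as state $\bar x_k$ together with the shift-register states; $\hat{\mathcal{A}},\hat{\mathcal{B}}$ do not depend on $\lambda$, while $\hat{\mathcal{C}}(\lambda),\hat{\mathcal{D}}(\lambda)$ are affine in $\lambda$. *)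

(* Defs.v *)
From HB Require Import structures.
From mathcomp Require Import all_boot all_order all_algebra.
From mathcomp Require Import all_classical all_reals all_analysis.
From mathcomp Require Import mxtens complex.

Set Implicit Arguments.
Unset Strict Implicit.
Unset Printing Implicit Defensive.
Import Order.TTheory GRing.Theory Num.Theory.
Import numFieldNormedType.Exports.
Local Open Scope classical_set_scope.
Local Open Scope ring_scope.

(* Vectors are columns.                                                       *)
(* R^(sc) is 'cV[R]_(s * c); entry (mxtens_index (i, k)) is the k-th          *)
(* coordinate of the i-th block, the ordering used by the Kronecker product   *)
(* tensmx (notation *t).                                                      *)

Definition dotv (R : realType) (n : nat) (u v : 'cV[R]_n) : R :=
  \sum_i u i 0 * v i 0.

(* The norm that the library puts on matrices is the sup norm, hence: *)
Definition norm2 (R : realType) (n : nat) (v : 'cV[R]_n) : R :=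
  Num.sqrt (\sum_i v i 0 ^+ 2).

Definition blk (R : realType) (s c : nat) (i : 'I_s) (z : 'cV[R]_(s * c)) :
  'cV[R]_c := \col_k z (mxtens_index (i, k)) 0.

Definition onesI (R : realType) (s c : nat) : 'M[R]_(s * c, c) :=
  castmx (erefl, mul1n c) ((const_mx 1 : 'cV[R]_s) *t (1%:M : 'M[R]_c)).

Definition diagI (R : realType) (s c : nat) (a : 'I_s -> R) : 'M[R]_(s * c) :=
  diag_mx (\row_i a i) *t (1%:M : 'M[R]_c).

Definition block_lower_triangular (R : realType) (s c : nat)
    (D : 'M[R]_(s * c)) : Prop :=
  forall (i j : 'I_s) (k l : 'I_c), (i < j)%N ->
    D (mxtens_index (i, k)) (mxtens_index (j, l)) = 0.

Definition posdef (R : realType) (n : nat) (M : 'M[R]_n) : Prop :=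
  M^T = M /\ forall v : 'cV[R]_n, v != 0 -> 0 < dotv v (M *m v).

Definition negdef (R : realType) (n : nat) (M : 'M[R]_n) : Prop :=
  posdef (- M).

(** * Function and operator classes *)

Definition qf (R : realType) (c : nat) (x : 'cV[R]_c) : R :=
  2^-1 * norm2 x ^+ 2.

Definition proper (R : realType) (c : nat) (g : 'cV[R]_c -> \bar R) : Prop :=
  (forall x, g x != -oo%E) /\ exists x, g x != +oo%E.

(* Only used for proper g, so that oo - oo does not occur on the right. *)
Definition convex_fun (R : realType) (c : nat) (g : 'cV[R]_c -> \bar R) :
    Prop :=
  forall (x y : 'cV[R]_c) (t : R), 0 < t -> t < 1 ->
    (g (t *: x + (1 - t) *: y)%R <= t%:E * g x + (1 - t)%:E * g y)%E.

Definition closed_fun (R : realType) (c : nat) (g : 'cV[R]_c -> \bar R) :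
    Prop :=
  closed [set p : 'cV[R]_c * R | (g p.1 <= p.2%:E)%E].

Definition pcc (R : realType) (c : nat) (g : 'cV[R]_c -> \bar R) : Prop :=
  [/\ proper g, convex_fun g & closed_fun g].

Definition shift_qf (R : realType) (c : nat) (m : R)
    (f : 'cV[R]_c -> \bar R) : 'cV[R]_c -> \bar R :=
  fun x => (f x - (m * qf x)%:E)%E.

Definition Sclass (R : realType) (c : nat) (m : R) (L : \bar R)
    (f : 'cV[R]_c -> \bar R) : Prop :=
  pcc (shift_qf m f) /\
  (if L is l%:E then pcc (fun x => ((l * qf x)%:E - f x)%E) else True).

(* For proper g the set is empty wherever g is +oo. *)
Definition csubdiff (R : realType) (c : nat) (g : 'cV[R]_c -> \bar R)
    (x : 'cV[R]_c) : set 'cV[R]_c :=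
  [set v | forall y, (g x + (dotv v (y - x))%:E <= g y)%E].

Definition subdiff (R : realType) (c : nat) (m : R) (f : 'cV[R]_c -> \bar R)
    (x : 'cV[R]_c) : set 'cV[R]_c :=
  [set v + m *: x | v in csubdiff (shift_qf m f) x].

Definition operator (R : realType) (n : nat) := 'cV[R]_n -> set 'cV[R]_n.

Definition Oclass (R : realType) (s c : nat) (m : 'I_s -> R)
    (L : 'I_s -> \bar R) (F : operator R (s * c)) : Prop :=
  exists f : 'I_s -> 'cV[R]_c -> \bar R,
    [/\ forall i, Sclass (m i) (L i) (f i),
        F = (fun z => [set w | forall i,
                        subdiff (m i) (f i) (blk i z) (blk i w)])
      & exists! bw : 'cV[R]_c * 'cV[R]_(s * c),
          \sum_i blk i bw.2 = 0 /\
          forall i, subdiff (m i) (f i) bw.1 (blk i bw.2)].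

Definition op_inv (R : realType) (n : nat) (F : operator R n) : operator R n :=
  fun x => [set y | F y x].

Definition op_sub_mx (R : realType) (n : nat) (F : operator R n)
    (D : 'M[R]_n) : operator R n :=
  fun x => [set y - D *m x | y in F x].

Definition globally_continuous (R : realType) (n : nat) (F : operator R n) :
    Prop :=
  exists g : 'cV[R]_n -> 'cV[R]_n,
    continuous g /\ forall x, F x = [set g x].

(** * Linear systems *)

(* x+ = ssA x + ssB w, z = ssC x + ssD w *)
Record ss (R : realType) (n p q : nat) := SS {
  ssA : 'M[R]_n;
  ssB : 'M[R]_(n, p);
  ssC : 'M[R]_(q, n);
  ssD : 'M[R]_(q, p) }.

(* x+ = nA x + nB1 w + nB2 u, z = nC1 x + nD1 w + nD12 u,
   y = nC2 x + nD21 w + nD2 u, where w and z have dimension p *)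
Record network (R : realType) (n p nu ny : nat) := Network {
  nA : 'M[R]_n;         nB1 : 'M[R]_(n, p);   nB2 : 'M[R]_(n, nu);
  nC1 : 'M[R]_(p, n);   nD1 : 'M[R]_(p, p);   nD12 : 'M[R]_(p, nu);
  nC2 : 'M[R]_(ny, n);  nD21 : 'M[R]_(ny, p); nD2 : 'M[R]_(ny, nu) }.

Definition PK_well_posed (R : realType) (n p nu ny nc : nat)
    (P : network R n p nu ny) (K : ss R nc ny nu) : Prop :=
  1%:M - nD2 P *m ssD K \in unitmx.

(* Obtained by solving the loop equations for
   y = (I - D2 Dc)^-1 (C2 x + D2 Cc xi + D21 w) and u = Cc xi + Dc y. *)
Definition PK (R : realType) (n p nu ny nc : nat)
    (P : network R n p nu ny) (K : ss R nc ny nu) : ss R (n + nc) p p :=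
  let J := invmx (1%:M - nD2 P *m ssD K) in
  let yx := row_mx (J *m nC2 P) (J *m nD2 P *m ssC K) in
  let yw := J *m nD21 P in
  let ux := row_mx 0 (ssC K) + ssD K *m yx in
  let uw := ssD K *m yw in
  SS (col_mx (row_mx (nA P) 0 + nB2 P *m ux)
             (row_mx 0 (ssA K) + ssB K *m yx))
     (col_mx (nB1 P + nB2 P *m uw) (ssB K *m yw))
     (row_mx (nC1 P) 0 + nD12 P *m ux)
     (nD1 P + nD12 P *m uw).

Definition schur_stable (R : realType) (n : nat) (A : 'M[R]_n) : Prop :=
  forall l : R[i], eigenvalue (map_mx (real_complex R) A) l -> `|l| < 1.

Definition stabilizable (R : realType) (n p : nat)
    (A : 'M[R]_n) (B : 'M[R]_(n, p)) : Prop :=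
  exists G : 'M[R]_(p, n), schur_stable (A + B *m G).

Definition detectable (R : realType) (n q : nat)
    (A : 'M[R]_n) (C : 'M[R]_(q, n)) : Prop :=
  exists G : 'M[R]_(n, q), schur_stable (A + G *m C).

(** * Consensus matrix and standing assumptions on the network *)

Definition consensus_matrix (R : realType) (s c : nat)
    (N : 'M[R]_(s * c, s.-1 * c)) : Prop :=
  \rank N = (s.-1 * c)%N /\
  forall v : 'cV[R]_(s * c),
    (exists u : 'cV[R]_(s.-1 * c), v = N *m u) <-> (onesI R s c)^T *m v = 0.

Definition Em (R : realType) (n s c nu ny : nat) (m : 'I_s -> R)
    (P : network R n (s * c) nu ny) : 'M[R]_(s * c) :=
  1%:M - nD1 P *m diagI c m.

Definition Wm (R : realType) (n s c nu ny : nat) (m : 'I_s -> R)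
    (P : network R n (s * c) nu ny) : 'M[R]_(s * c) :=
  diagI c m *m invmx (Em m P).

Definition Am (R : realType) (n s c nu ny : nat) (m : 'I_s -> R)
    (P : network R n (s * c) nu ny) : 'M[R]_n :=
  nA P + nB1 P *m Wm m P *m nC1 P.

Definition B2m (R : realType) (n s c nu ny : nat) (m : 'I_s -> R)
    (P : network R n (s * c) nu ny) : 'M[R]_(n, nu) :=
  nB2 P + nB1 P *m Wm m P *m nD12 P.

Definition C2m (R : realType) (n s c nu ny : nat) (m : 'I_s -> R)
    (P : network R n (s * c) nu ny) : 'M[R]_(ny, n) :=
  nC2 P + nD21 P *m Wm m P *m nC1 P.

(* The width c + s.-1 * c is s * c when 0 < s. *)
Definition B1m (R : realType) (n s c nu ny : nat) (m : 'I_s -> R)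
    (N : 'M[R]_(s * c, s.-1 * c)) (P : network R n (s * c) nu ny) :
    'M[R]_(n, c + s.-1 * c) :=
  row_mx 0 (nB1 P *m N) +
  nB1 P *m Wm m P *m row_mx (onesI R s c) (nD1 P *m N).

Definition D21m (R : realType) (n s c nu ny : nat) (m : 'I_s -> R)
    (N : 'M[R]_(s * c, s.-1 * c)) (P : network R n (s * c) nu ny) :
    'M[R]_(ny, c + s.-1 * c) :=
  row_mx 0 (nD21 P *m N) +
  nD21 P *m Wm m P *m row_mx (onesI R s c) (nD1 P *m N).

Definition assumption1 (R : realType) (n s c nu ny : nat) (m : 'I_s -> R)
    (P : network R n (s * c) nu ny) : Prop :=
  Em m P \in unitmx.

Definition assumption2 (R : realType) (n s c nu ny : nat) (m : 'I_s -> R)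
    (P : network R n (s * c) nu ny) : Prop :=
  stabilizable (Am m P) (B2m m P) /\ detectable (Am m P) (C2m m P).

Definition assumption3 (R : realType) (n s c nu ny : nat)
    (P : network R n (s * c) nu ny) : Prop :=
  \rank (block_mx (nA P - 1%:M) (nB2 P) (nC1 P) (nD12 P)) = (n + nu)%N.

Definition assumption4 (R : realType) (n s c nu ny : nat) (m : 'I_s -> R)
    (N : 'M[R]_(s * c, s.-1 * c)) (P : network R n (s * c) nu ny) : Prop :=
  detectable (block_mx (Am m P) (B1m m N P) 0 1%:M)
             (row_mx (C2m m P) (D21m m N P)).

(** * Conditions on the controller *)

Definition regulator_equations (R : realType) (n s c nu ny nc : nat)
    (N : 'M[R]_(s * c, s.-1 * c)) (P : network R n (s * c) nu ny)
    (K : ss R nc ny nu) : Prop :=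
  exists (Pi : 'M[R]_(n, c + s.-1 * c)) (Theta : 'M[R]_(nc, c + s.-1 * c))
         (Gam : 'M[R]_(nu, c + s.-1 * c)) (Phi : 'M[R]_(ny, c + s.-1 * c)),
    [/\ nA P *m Pi + row_mx 0 (nB1 P *m N) + nB2 P *m Gam = Pi,
        nC1 P *m Pi + row_mx (onesI R s c) (nD1 P *m N) + nD12 P *m Gam = 0,
        nC2 P *m Pi + row_mx 0 (nD21 P *m N) + nD2 P *m Gam = Phi,
        ssA K *m Theta + ssB K *m Phi = Theta
      & ssC K *m Theta + ssD K *m Phi = Gam].

Definition sigma (R : realType) (s : nat) (m : 'I_s -> R)
    (L : 'I_s -> \bar R) (i : 'I_s) : R :=
  if L i is l%:E then (l - m i)^-1 else 0.

(* Sigma_{m,L} * G-bar, from q to p: solving the loop gives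
   w = (I - m D)^-1 (q + m C x), z = C x + D w, p = z - sigma q. *)
Definition SigmaG (R : realType) (n s c : nat) (m : 'I_s -> R)
    (L : 'I_s -> \bar R) (rho : R) (S : ss R n (s * c) (s * c)) :
    ss R n (s * c) (s * c) :=
  let J := invmx (1%:M - diagI c m *m ssD S) in
  let wx := J *m diagI c m *m ssC S in
  SS (rho^-1 *: (ssA S + ssB S *m wx))
     (rho^-1 *: (ssB S *m J))
     (ssC S + ssD S *m wx)
     (ssD S *m J - diagI c (sigma m L)).

(* Filter r^i_k = \sum_nu lam i nu * p^i_(k - nu) for i < s.  The state lives *)
(* in R^(s * (nmax * c)): entry (i, (a, k)), a < nmax, is the k-th coordinate *)
(* of p^i delayed by a + 1 steps.                                             *)
Definition Psi (R : realType) (s c nmax : nat)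
    (lam : 'I_s -> 'I_nmax.+1 -> R) :
    ss R (s * (nmax * c)) (s * c) (s * c) :=
  SS ((1%:M : 'M[R]_s) *t
        ((\matrix_(a, b) ((a : nat) == b.+1)%:R : 'M[R]_nmax)
          *t (1%:M : 'M[R]_c)))
     ((1%:M : 'M[R]_s) *t
        castmx (erefl, mul1n c)
          ((\col_a ((a : nat) == 0%N)%:R : 'cV[R]_nmax) *t (1%:M : 'M[R]_c)))
     (\matrix_(x, y)
        let: (i, k) := mxtens_unindex x in
        let: (j, ab) := mxtens_unindex y in
        let: (a, l) := mxtens_unindex ab in
        ((i == j) && (k == l))%:R * lam i (lift ord0 a))
     (diagI c (fun i => lam i ord0)).

Definition series_conn (R : realType) (n1 n2 p q r : nat)
    (S2 : ss R n2 q r) (S1 : ss R n1 p q) : ss R (n1 + n2) p r :=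
  SS (block_mx (ssA S1) 0 (ssB S2 *m ssC S1) (ssA S2))
     (col_mx (ssB S1) (ssB S2 *m ssD S1))
     (row_mx (ssD S2 *m ssC S1) (ssC S2))
     (ssD S2 *m ssD S1).

Definition GPsi (R : realType) (n s c nmax : nat) (m : 'I_s -> R)
    (L : 'I_s -> \bar R) (rho : R) (S : ss R n (s * c) (s * c))
    (lam : 'I_s -> 'I_nmax.+1 -> R) :
    ss R (n + s * (nmax * c)) (s * c) (s * c) :=
  series_conn (Psi c lam) (SigmaG m L rho S).

Definition LMI_lhs (R : realType) (n p : nat) (G : ss R n p p)
    (M : 'M[R]_n) : 'M[R]_(n + p) :=
  let U := block_mx (ssA G) (ssB G) 1%:M 0 in
  let V := block_mx (ssC G) (ssD G) 0 1%:M in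
  U^T *m block_mx M 0 0 (- M) *m U +
  2^-1 *: (V^T *m block_mx 0 1%:M 1%:M 0 *m V).

Definition robust_stability (R : realType) (n s c : nat) (nmax : nat)
    (m : 'I_s -> R) (L : 'I_s -> \bar R) (rho : R)
    (S : ss R n (s * c) (s * c)) : Prop :=
  1%:M - diagI c m *m ssD S \in unitmx /\
  exists (M : 'M[R]_(n + s * (nmax * c))) (lam : 'I_s -> 'I_nmax.+1 -> R),
    [/\ posdef M,
        negdef (LMI_lhs (GPsi m L rho S lam) M),
        forall i, 0 < \sum_(nu < nmax.+1) rho ^- nu * lam i nu
      & forall i (nu : 'I_nmax.+1), (1 <= nu)%N -> lam i nu <= 0].

(** * The algorithm: w_k \in F z_k in feedback with a linear system *)

Definition well_posed (R : realType) (n p : nat) (F : operator R p)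
    (S : ss R n p p) : Prop :=
  globally_continuous (op_inv (op_sub_mx (op_inv F) (ssD S))).

Definition trajectory (R : realType) (n p : nat) (F : operator R p)
    (S : ss R n p p) (x : nat -> 'cV[R]_n) (w z : nat -> 'cV[R]_p) : Prop :=
  forall k, [/\ x k.+1 = ssA S *m x k + ssB S *m w k,
                z k = ssC S *m x k + ssD S *m w k
              & F (z k) (w k)].

Definition fixed_point (R : realType) (n p : nat) (F : operator R p)
    (S : ss R n p p) (x : 'cV[R]_n) (w z : 'cV[R]_p) : Prop :=
  [/\ x = ssA S *m x + ssB S *m w,
      z = ssC S *m x + ssD S *m w
    & F z w].

Definition convergent_to (R : realType) (n s c : nat)
    (F : operator R (s * c)) (S : ss R n (s * c) (s * c))
    (xs : 'cV[R]_n) (ws zs : 'cV[R]_(s * c)) : Prop :=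
  [/\ fixed_point F S xs ws zs,
      exists beta : 'cV[R]_c, zs = onesI R s c *m beta,
      (onesI R s c)^T *m ws = 0
    & forall x w z, trajectory F S x w z ->
        [/\ x @ \oo --> xs, w @ \oo --> ws & z @ \oo --> zs]].

Definition convergent (R : realType) (n s c : nat)
    (F : operator R (s * c)) (S : ss R n (s * c) (s * c)) : Prop :=
  exists xs ws zs, convergent_to F S xs ws zs.

(* gamma is uniform over the class of operators O. *)
Definition exp_convergent (R : realType) (n s c : nat)
    (O : operator R (s * c) -> Prop) (S : ss R n (s * c) (s * c)) (rho : R) :
    Prop :=
  (forall F, O F -> convergent F S) /\
  exists2 gamma : R, 0 < gamma &
    forall F, O F -> forall xs ws zs, convergent_to F S xs ws zs ->
    forall x w z, trajectory F S x w z -> forall k : nat,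
      Num.max (norm2 (x k - xs))
        (Num.max (norm2 (w k - ws)) (norm2 (z k - zs)))
      <= gamma * rho ^+ k * norm2 (x 0%N - xs).

(* Main.v *)
From mathcomp Require Import all_boot all_order all_algebra.
From mathcomp Require Import all_classical all_reals all_analysis.
From mathcomp Require Import mxtens ring lra.
Require Import Defs.

Set Implicit Arguments.
Unset Strict Implicit.
Unset Printing Implicit Defensive.
Import Order.TTheory GRing.Theory Num.Theory.
Import numFieldNormedType.Exports.
Local Open Scope classical_set_scope.
Local Open Scope ring_scope.

(** Write [g_i = f_i - m_i |.|^2 / 2], a closed convex function, and
    [q = w - m z], so that [w] in [F z] says that the blocks of [q] are
    subgradients of the [g_i] at the blocks of [z]. With
    [p = z - sigma q], the curvature bound [L_i] becomes the monotonicity of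
    the relation between [q] and [p]; more precisely ([interpolation]), with
    [phi = g_i(z) - g_i(z') - q' (z - z') - sigma_i / 2 |q - q'|^2] taken
    relative to an equilibrium [(z', q')], one has [phi >= 0] and
    [q_k (p_k - p_j) >= phi_k - phi_j] along deviations from it
    ([storage_ge0], [storage_diff]).

    Exponential bound. Scale the deviations at time [k] by [rho ^- k]. The
    matrix inequality says that the quadratic form of [M] decreases along the
    scaled trajectory by at least the product of [q] with the filtered [p],
    plus a positive multiple of the squared norms ([LMI_dissipation]). The sum
    of these products over any initial time interval is nonnegative: the
    delayed filter coefficients are nonpositive and the weighted sum of all of
    them is positive, so the inequalities for [phi] add up
    ([weighted_supply_ge0], [multiplier_ge0]). Hence the scaled deviations
    remain below a multiple of the initial deviation, and the multiple depends
    on [M], the filter coefficients and the system only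
    ([exponential_bound]).

    Well-posedness. The lower right corner of the matrix inequality says that
    the feedthrough from [q] to [p], weighted by the undelayed filter
    coefficients, is strongly monotone with the opposite sign. The algebraic
    loop is therefore an inclusion with a monotone relation having resolvents
    ([sigma_resolvent]) plus a strongly monotone, in general nonsymmetric,
    matrix. Forward-backward splitting solves it
    ([strongly_monotone_surjective]), and strong monotonicity makes the
    solution unique and Lipschitz ([strongly_monotone_lipschitz],
    [loop_well_posed]).

    Equilibrium. The regulator equations provide, for the optimiser [beta] and
    the multipliers [w* = N v], a fixed point with all outputs equal to [beta]
    ([regulator_equilibrium]), to which the exponential bound applies. *)

(** * Euclidean geometry of column vectors *)

Section Euclid.
Context {R : realType}.
Implicit Types n p : nat.

Lemma dotvE n (u v : 'cV[R]_n) : dotv u v = (u^T *m v) 0 0.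
Proof. by rewrite /dotv mxE; apply: eq_bigr => i _; rewrite mxE. Qed.

Lemma dotvC n (u v : 'cV[R]_n) : dotv u v = dotv v u.
Proof. by apply: eq_bigr => i _; rewrite mulrC. Qed.

Lemma dotvDl n (u v w : 'cV[R]_n) : dotv (u + v) w = dotv u w + dotv v w.
Proof. by rewrite !dotvE linearD /= mulmxDl mxE. Qed.

Lemma dotvDr n (u v w : 'cV[R]_n) : dotv w (u + v) = dotv w u + dotv w v.
Proof. by rewrite !dotvE mulmxDr mxE. Qed.

Lemma dotvZl n a (u v : 'cV[R]_n) : dotv (a *: u) v = a * dotv u v.
Proof. by rewrite !dotvE linearZ /= -scalemxAl mxE. Qed.

Lemma dotvZr n a (u v : 'cV[R]_n) : dotv u (a *: v) = a * dotv u v.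
Proof. by rewrite dotvC dotvZl dotvC. Qed.

Lemma dotvNl n (u v : 'cV[R]_n) : dotv (- u) v = - dotv u v.
Proof. by rewrite -scaleN1r dotvZl mulN1r. Qed.

Lemma dotvNr n (u v : 'cV[R]_n) : dotv u (- v) = - dotv u v.
Proof. by rewrite dotvC dotvNl dotvC. Qed.

Lemma dotvBl n (u v w : 'cV[R]_n) : dotv (u - v) w = dotv u w - dotv v w.
Proof. by rewrite dotvDl dotvNl. Qed.

Lemma dotvBr n (u v w : 'cV[R]_n) : dotv w (u - v) = dotv w u - dotv w v.
Proof. by rewrite dotvDr dotvNr. Qed.

Lemma dotv0l n (u : 'cV[R]_n) : dotv 0 u = 0.
Proof. by rewrite -(scale0r 0) dotvZl mul0r. Qed.

Lemma dotv0r n (u : 'cV[R]_n) : dotv u 0 = 0.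
Proof. by rewrite dotvC dotv0l. Qed.

Lemma dotv_suml n (I : finType) (u : I -> 'cV[R]_n) v :
  dotv (\sum_i u i) v = \sum_i dotv (u i) v.
Proof.
by apply: (big_morph (fun u => dotv u v)) => [x y|]; rewrite ?dotvDl ?dotv0l.
Qed.

Definition dotv_lin := (dotvDl, dotvDr, dotvNl, dotvNr, dotvZl, dotvZr).

Lemma dotv_mulmx n p (A : 'M[R]_(n, p)) u v :
  dotv u (A *m v) = dotv (A^T *m u) v.
Proof. by rewrite !dotvE trmx_mul trmxK mulmxA. Qed.

Lemma dotv_col n p (a b : 'cV[R]_n) (u v : 'cV[R]_p) :
  dotv (col_mx a u) (col_mx b v) = dotv a b + dotv u v.
Proof. by rewrite !dotvE tr_col_mx mul_row_col mxE. Qed.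

Lemma dotvv_ge0 n (v : 'cV[R]_n) : 0 <= dotv v v.
Proof. by apply: sumr_ge0 => i _; rewrite -expr2 sqr_ge0. Qed.

Lemma dotvv_eq0 n (v : 'cV[R]_n) : dotv v v = 0 -> v = 0.
Proof.
move/eqP; rewrite psumr_eq0; last by move=> i _; rewrite -expr2 sqr_ge0.
move/allP => h; apply/colP => i; rewrite mxE.
by have := h i (mem_index_enum _); rewrite /= -expr2 sqrf_eq0 => /eqP.
Qed.

Lemma norm2E n (v : 'cV[R]_n) : norm2 v = Num.sqrt (dotv v v).
Proof. by []. Qed.

Lemma norm2_ge0 n (v : 'cV[R]_n) : 0 <= norm2 v.
Proof. exact: sqrtr_ge0. Qed.

Lemma norm2_sqr n (v : 'cV[R]_n) : norm2 v ^+ 2 = dotv v v.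
Proof. by rewrite norm2E sqr_sqrtr // dotvv_ge0. Qed.

Lemma norm2_eq0 n (v : 'cV[R]_n) : norm2 v = 0 -> v = 0.
Proof. by move=> h; apply: dotvv_eq0; rewrite -norm2_sqr h expr0n. Qed.

Lemma norm2_0 n : norm2 (0 : 'cV[R]_n) = 0.
Proof. by rewrite norm2E dotv0l sqrtr0. Qed.

Lemma norm2Z n a (v : 'cV[R]_n) : norm2 (a *: v) = `|a| * norm2 v.
Proof.
by rewrite norm2E !dotv_lin mulrA -expr2 sqrtrM ?sqr_ge0 // sqrtr_sqr.
Qed.

Lemma norm2N n (v : 'cV[R]_n) : norm2 (- v) = norm2 v.
Proof. by rewrite norm2E !dotv_lin opprK. Qed.

Lemma norm2_le n p (u : 'cV[R]_n) (v : 'cV[R]_p) C : 0 <= C ->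
  dotv u u <= C ^+ 2 * dotv v v -> norm2 u <= C * norm2 v.
Proof.
move=> C0 h; rewrite -(@ler_pXn2r _ 2) ?nnegrE ?norm2_ge0 //.
  by rewrite exprMn !norm2_sqr.
by rewrite mulr_ge0 // norm2_ge0.
Qed.

Lemma CauchySchwarz_sqr n (u v : 'cV[R]_n) :
  dotv u v ^+ 2 <= dotv u u * dotv v v.
Proof.
have [v0|v0] := eqVneq (dotv v v) 0.
  by rewrite (dotvv_eq0 v0) !dotv0r expr0n mulr0.
have vgt0 : 0 < dotv v v by rewrite lt_def v0 dotvv_ge0.
have := dotvv_ge0 (dotv v v *: u - dotv u v *: v).
rewrite !dotv_lin (dotvC v u) => h.
have {}h : 0 <= dotv v v * (dotv u u * dotv v v - dotv u v ^+ 2).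
  by apply: le_trans h _; rewrite le_eqVlt; apply/orP; left; apply/eqP; ring.
by rewrite -subr_ge0; rewrite pmulr_rge0 in h.
Qed.

Lemma CauchySchwarz n (u v : 'cV[R]_n) : dotv u v <= norm2 u * norm2 v.
Proof.
apply: le_trans (ler_norm _) _.
rewrite -(@ler_pXn2r _ 2) ?nnegrE ?normr_ge0 ?mulr_ge0 ?norm2_ge0 //.
by rewrite real_normK ?num_real // exprMn !norm2_sqr CauchySchwarz_sqr.
Qed.

Lemma norm2D n (u v : 'cV[R]_n) : norm2 (u + v) <= norm2 u + norm2 v.
Proof.
rewrite -(@ler_pXn2r _ 2) ?nnegrE ?addr_ge0 ?norm2_ge0 //.
rewrite norm2_sqr !dotv_lin (dotvC v u) sqrrD !norm2_sqr.
by have := CauchySchwarz u v; lra.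
Qed.

Lemma norm2_entry n (v : 'cV[R]_n) i : `|v i 0| <= norm2 v.
Proof.
rewrite -(@ler_pXn2r _ 2) ?nnegrE ?normr_ge0 ?norm2_ge0 //.
rewrite norm2_sqr real_normK ?num_real // expr2 /dotv (bigD1 i) //= lerDl.
by apply: sumr_ge0 => j _; rewrite -expr2 sqr_ge0.
Qed.

Lemma norm2_mulmx n p (A : 'M[R]_(n, p)) :
  exists2 C : R, 0 <= C & forall v, norm2 (A *m v) <= C * norm2 v.
Proof.
pose C := Num.sqrt (\sum_i dotv (row i A)^T (row i A)^T).
have C2 : C ^+ 2 = \sum_i dotv (row i A)^T (row i A)^T.
  by rewrite sqr_sqrtr // sumr_ge0 // => i _; apply: dotvv_ge0.
exists C; first exact: sqrtr_ge0.
move=> v; apply: norm2_le; first exact: sqrtr_ge0.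
rewrite C2 mulr_suml; apply: ler_sum => i _.
have -> : (A *m v) i 0 = dotv (row i A)^T v.
  by rewrite dotvE trmxK -row_mul [RHS]mxE.
by rewrite -expr2 CauchySchwarz_sqr.
Qed.

(** * Topology of column vectors *)

Lemma dotvv_continuous n : continuous (fun v : 'cV[R]_n => dotv v v).
Proof.
apply: (@continuous_big R 'I_n +%R 0 xpredT (@add_continuous R)) => i _ v.
by apply: continuousM; exact: coord_continuous.
Qed.

Lemma norm2_continuous n : continuous (@norm2 R n).
Proof.
move=> v; apply: (@continuous_comp _ _ _ (fun v => dotv v v) Num.sqrt).
  exact: dotvv_continuous.
exact: sqrt_continuous.
Qed.

Lemma mx_norm_le_norm2 n (v : 'cV[R]_n) : `|v| <= norm2 v.
Proof.
rewrite /Num.norm /= mx_normrE; apply/bigmax_leP; split; first exact: norm2_ge0.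
by move=> [i j] _ /=; rewrite ord1; exact: norm2_entry.
Qed.

(** Convergence and continuity refer to the sup norm of matrices, all estimates
    to [norm2]; the two comparisons with [mx_norm] are the bridge. *)
Lemma norm2_le_mx_norm n (v : 'cV[R]_n) : norm2 v <= Num.sqrt n%:R * `|v|.
Proof.
rewrite -(@ler_pXn2r _ 2) ?nnegrE ?mulr_ge0 ?norm2_ge0 ?sqrtr_ge0 //.
rewrite norm2_sqr exprMn sqr_sqrtr ?ler0n // /dotv.
apply: (@le_trans _ _ (\sum_(i < n) `|v| ^+ 2)).
  apply: ler_sum => i _; rewrite -expr2 -[leLHS]real_normK ?num_real //.
  rewrite ler_pXn2r ?nnegrE // [leRHS]/Num.norm /= mx_normrE.
  by apply: (le_bigmax _ (fun ij => `|v ij.1 ij.2|) (i, 0)).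
by rewrite sumr_const card_ord mulr_natl.
Qed.

Lemma lipschitz2_continuous n p (g : 'cV[R]_n -> 'cV[R]_p) C : 0 <= C ->
  (forall x y, norm2 (g x - g y) <= C * norm2 (x - y)) -> continuous g.
Proof.
move=> C0 gC x; apply/(@cvgrPdist_lt _ _ _ (nbhs x) _ g (g x)) => e e0.
pose D := C * Num.sqrt n%:R + 1.
have D0 : 0 < D by rewrite ltr_wpDl // mulr_ge0 // sqrtr_ge0.
have : \forall y \near x, `|x - y| < e / D.
  have eD : 0 < e / D by rewrite divr_gt0.
  have := @nbhsx_ballx _ _ x _ eD.
  by rewrite -ball_normE.
apply: filterS => y; rewrite ltr_pdivlMr // mulrC => h.
apply: le_lt_trans (mx_norm_le_norm2 _) (le_lt_trans (gC _ _) _).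
apply: le_lt_trans h; rewrite mulrDl mul1r -mulrA ler_wpDr //.
by rewrite ler_wpM2l // norm2_le_mx_norm.
Qed.

Lemma trmx_continuous n p : continuous (@trmx R n p).
Proof.
move=> x; apply/(@cvgrPdist_lt _ _ _ (nbhs x) _ trmx x^T) => e e0.
near=> y; rewrite -linearB /=.
have -> : `|(x - y)^T| = `|x - y|.
  rewrite /Num.norm /= !mx_normrE; apply/le_anti/andP; split.
    apply/bigmax_leP; split; first exact: bigmax_ge_id.
    by move=> [i j] _ /=; rewrite mxE; apply: (le_bigmax _ _ (j, i)).
  apply/bigmax_leP; split; first exact: bigmax_ge_id.
  move=> [i j] _ /=; have -> : (x - y) i j = (x - y)^T j i by rewrite [RHS]mxE.
  by apply: (le_bigmax _ (fun ij => `|(x - y)^T ij.1 ij.2|) (j, i)).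
near: y.
exact: cvgr_dist_lt.
Unshelve. all: by end_near.
Qed.

Lemma compact_ball2 n (r : R) : compact [set v : 'cV[R]_n | norm2 v <= r].
Proof.
have -> : [set v : 'cV[R]_n | norm2 v <= r] =
    trmx @` [set v : 'rV[R]_n | norm2 v^T <= r].
  apply/seteqP; split => [v /= h|_ [v /= h <-] //].
  by exists v^T; rewrite /= trmxK.
apply: continuous_compact.
  by apply: continuous_subspaceT => v; exact: trmx_continuous.
apply: bounded_closed_compact.
  exists r; split; first exact: num_real.
  move=> x rx v /= vr; apply: le_trans _ (ltW rx).
  rewrite /Num.norm /= mx_normrE; apply/bigmax_leP; split.
    exact: le_trans (norm2_ge0 _) vr.
  move=> [i j] _ /=; rewrite ord1; apply: le_trans _ vr.
  by have := norm2_entry v^T j; rewrite mxE.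
apply: (@closed_comp _ _ (fun v => norm2 v^T) [set x | x <= r]).
  move=> v _; apply: (@continuous_comp _ _ _ trmx (@norm2 R n)).
    exact: trmx_continuous.
  exact: norm2_continuous.
exact: closed_le.
Qed.

(** Compactness of the unit sphere turns strict positivity into a margin; this
    margin is the dissipation rate extracted from the matrix inequality. *)
Lemma posdef_coercive n (M : 'M[R]_n) : posdef M ->
  exists2 e : R, 0 < e & forall v, e * dotv v v <= dotv v (M *m v).
Proof.
move=> [_ Mpos].
pose S := [set v : 'cV[R]_n | norm2 v <= 1] `&` [set v | norm2 v = 1].
have Sc : compact S.
  apply: compact_closedI (@compact_ball2 _ _) _.
  apply: (@closed_comp _ _ (@norm2 R n) [set x | x = 1]).
    by move=> v _; exact: norm2_continuous.
  exact: closed_eq.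
have fc : continuous (fun v : 'cV[R]_n => dotv v (M *m v)).
  apply: (@continuous_big R 'I_n +%R 0 xpredT (@add_continuous R)) => i _ v.
  apply: continuousM; first exact: coord_continuous.
  have [C C0 MC] := norm2_mulmx M.
  apply: (@continuous_comp _ _ _ (mulmx M) (fun w : 'cV[R]_n => w i 0)).
    apply: (@lipschitz2_continuous _ _ _ C C0) => x y.
    by rewrite -mulmxBr.
  exact: coord_continuous.
have scale (v : 'cV[R]_n) : v != 0 -> S ((norm2 v)^-1 *: v).
  move=> v0; have nv : norm2 v != 0.
    by apply: contra_neq v0; exact: norm2_eq0.
  have n1 : norm2 ((norm2 v)^-1 *: v) = 1.
    by rewrite norm2Z ger0_norm ?invr_ge0 ?norm2_ge0 // mulVf.
  by split; rewrite /= n1.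
have [S0|/nonemptyPn S0] := pselect (S !=set0); last first.
  exists 1 => // v; have [->|/scale] := eqVneq v 0; last by rewrite S0.
  by rewrite !(dotv0l, mulr0).
have [u] := compact_EVT_min S0 Sc (continuous_subspaceT fc).
rewrite inE => -[_ /= u1] umin.
have u0 : u != 0.
  by apply/eqP => u0; move: u1; rewrite u0 norm2_0 => /esym/eqP; rewrite oner_eq0.
exists (dotv u (M *m u)); first exact: Mpos.
move=> v; have [->|v0] := eqVneq v 0; first by rewrite !(dotv0l, mulr0).
have := umin _ (mem_set (scale _ v0)).
rewrite -scalemxAr !dotv_lin -norm2_sqr.
have nv : 0 < norm2 v.
  rewrite lt_def norm2_ge0 andbT.
  by apply: contra_neq v0; exact: norm2_eq0.
by rewrite mulrA -invfM -expr2 mulrC ler_pdivlMr ?exprn_gt0.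
Qed.

End Euclid.

(** * Minimisers and subgradients of closed convex functions *)

Section Convex.
Context {R : realType} {c : nat}.
Implicit Types (g : 'cV[R]_c -> \bar R) (x y z v q : 'cV[R]_c).

(** The sublevel sets form a filter base on the compact set [K], and closedness
    of the epigraph shows that a cluster point of it is a minimiser. *)
Lemma closed_fun_min g (K : set 'cV[R]_c) x0 : compact K -> closed_fun g ->
  K x0 -> (g x0 < +oo)%E -> exists2 z, K z & forall y, K y -> (g z <= g y)%E.
Proof.
move=> Kc gc Kx0 gx0.
pose D := [set r : R | exists2 t, K t & (g t <= r%:E)%E].
pose B (r : R) := K `&` [set t | (g t <= r%:E)%E].
have D0 : D !=set0.
  move: gx0; case E : (g x0) => [r| |] // _; last first.
    by exists 0, x0 => //; rewrite E leNye.
  by exists r, x0 => //; rewrite E.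
have FF : ProperFilter (filter_from D B).
  apply: filter_from_proper; last by move=> r [t Kt gt]; exists t.
  apply: filter_from_filter => // i j Di Dj.
  have [ij|ji] := lerP i j.
    exists i => // t [Kt gt]; split; split => //=.
    by apply: le_trans gt _; rewrite lee_fin.
  exists j => // t [Kt gt]; split; split => //=.
  by apply: le_trans gt _; rewrite lee_fin ltW.
have FK : filter_from D B K.
  by case: D0 => r Dr; exists r => // t [].
have [z [Kz clz]] := Kc _ FF FK.
exists z => // t Kt; rewrite leNgt; apply/negP => gtz.
have [r gtr rgz] : exists2 r : R, (g t <= r%:E)%E & (r%:E < g z)%E.
  move: gtz; case: (g t) => [a| |] //; case: (g z) => [b| |] // ab.
  - by exists a.
  - by exists a => //; exact: ltry.
  - by exists (b - 1); [exact: leNye | rewrite lte_fin ltrBlDr ltrDl].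
  - by exists 0; [exact: leNye | exact: ltry].
have : nbhs (z, r) (~` [set p : 'cV[R]_c * R | (g p.1 <= p.2%:E)%E]).
  apply: open_nbhs_nbhs; split; first exact: closed_openC.
  by apply/negP; rewrite -ltNge.
case=> -[/= U V] [Uz Vr] UV.
have FBr : filter_from D B (B r) by exists r => //; exists t.
have [y [[_ /= gy] Uy]] := clz (B r) U FBr Uz.
by apply: (UV (y, r)) => //; split => //=; exact: nbhs_singleton.
Qed.

(** Replaces a limit [t -> 0+] in the convexity arguments below. *)
Lemma le_of_le_addM_small (a b C : R) :
  (forall t, 0 < t -> t < 1 -> a <= b + t * C) -> a <= b.
Proof.
move=> h; rewrite leNgt; apply/negP => ba.
pose C' := Num.max C 0.
have C'0 : 0 <= C' by rewrite le_max lexx orbT.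
have CC' : C <= C' by rewrite le_max lexx.
pose t := (a - b) / (a - b + C' + 1).
have d0 : 0 < a - b by rewrite subr_gt0.
have D0 : 0 < a - b + C' + 1 by lra.
have t0 : 0 < t by rewrite divr_gt0.
have t1 : t < 1 by rewrite ltr_pdivrMr // mul1r; lra.
have := h _ t0 t1.
have tC : t * C <= t * C' by rewrite ler_wpM2l // ltW.
have tE : t * (a - b + C' + 1) = a - b by rewrite /t divfK // gt_eqF.
have : 0 < t * (a - b) by rewrite mulr_gt0.
by nra.
Qed.

Lemma convex_fun_real g x y (a b t : R) : proper g -> convex_fun g ->
  g x = a%:E -> g y = b%:E -> 0 < t -> t < 1 ->
  exists2 r : R, g (t *: x + (1 - t) *: y) = r%:E & r <= t * a + (1 - t) * b.
Proof.
move=> [gN _] gc gx gy t0 t1; have := gc x y t t0 t1; rewrite gx gy.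
have := gN (t *: x + (1 - t) *: y).
case: (g _) => [r| |] //= _; rewrite -!EFinM -EFinD ?lee_fin // => h.
by exists r.
Qed.

Lemma csubdiff_fin g z q : proper g -> csubdiff g z q ->
  g z = (fine (g z))%:E.
Proof.
move=> [gN [y gy]] /(_ y); have := gN z.
by case: (g z) => [r| |] //= _; move: gy; case: (g y).
Qed.

(** A strongly convex closed function has a minimiser: closedness bounds [g]
    below on a ball around a point of its domain, convexity propagates this
    to an affine lower bound along rays, and the quadratic term then confines
    the minimisation to a compact ball. The optimality condition is the
    resolvent equation [v = q + mu z], [q] a subgradient at [z]. *)
Lemma resolvent_exists g (mu : R) v : pcc g -> 0 < mu ->
  exists z, csubdiff g z (v - mu *: z).
Proof.
move=> [gp gc gcl] mu0; have [gN [x0 gx0]] := gp.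
have fing y : (g y < +oo)%E -> g y = (fine (g y))%:E.
  by have := gN y; case: (g y).
pose phi y := mu / 2 * dotv y y - dotv v y.
pose h y := (g y + (phi y)%:E)%E.
have phic : continuous phi.
  move=> y; apply: (@cvgB _ _ _ (nbhs y)).
    apply: (@cvgM _ _ (nbhs y)); first exact: cvg_cst.
    exact: dotvv_continuous.
  apply: (@continuous_big R 'I_c +%R 0 xpredT (@add_continuous R)) => i _ {}y.
  apply: continuousM; first exact: cst_continuous.
  exact: coord_continuous.
have hcl : closed_fun h.
  rewrite /closed_fun.
  have -> : [set p : 'cV[R]_c * R | (h p.1 <= p.2%:E)%E] =
      (fun p => (p.1, p.2 - phi p.1)) @^-1`
        [set p : 'cV[R]_c * R | (g p.1 <= p.2%:E)%E].
    by apply/seteqP; split => p /=; rewrite EFinB leeBrDr.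
  apply: (@closed_comp _ _ (fun p : 'cV[R]_c * R => (p.1, p.2 - phi p.1))
    [set p : 'cV[R]_c * R | (g p.1 <= p.2%:E)%E]) gcl => p _ /=.
  have c1 : (fun p : 'cV[R]_c * R => p.1) @ p --> p.1 by exact: cvg_fst.
  have c2 : (fun p : 'cV[R]_c * R => p.2 - phi p.1) @ p --> p.2 - phi p.1.
    apply: (@cvgB _ _ _ (nbhs p)); first exact: cvg_snd.
    apply: (@cvg_comp _ _ _ (@fst _ _) phi _ (nbhs p.1)); last exact: phic.
    exact: cvg_fst.
  exact: cvg_pair c1 c2.
have gx0' : (g x0 < +oo)%E by rewrite lt_neqAle gx0 leey.
set g0 := fine (g x0); have gx0E : g x0 = g0%:E by exact: fing.
have [c1 _ c1min] := closed_fun_min (@compact_ball2 R c (norm2 x0 + 1)) gcl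
  (ltW (ltr_pwDr ltr01 (lexx _)) : norm2 x0 <= norm2 x0 + 1) gx0'.
have gc1 : g c1 = (fine (g c1))%:E.
  apply: fing; apply: le_lt_trans gx0'; apply: c1min => /=.
  by rewrite lerDl.
set b := fine (g c1) in gc1.
have b_le y : norm2 y <= norm2 x0 + 1 -> (b%:E <= g y)%E.
  by move=> /c1min; rewrite gc1.
have bg0 : b <= g0 by rewrite -lee_fin -gx0E b_le // lerDl.
have g_lb y (r : R) : g y = r%:E -> 1 < norm2 (y - x0) ->
    g0 - norm2 (y - x0) * (g0 - b) <= r.
  move=> gy d1; set d := norm2 (y - x0) in d1 *.
  have d0 : 0 < d by lra.
  have t1 : d^-1 < 1 by rewrite invf_lt1.
  have [r' gu r'le] := convex_fun_real gp gc gy gx0E (etrans (invr_gt0 d) d0) t1.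
  have : b <= r'.
    rewrite -lee_fin -gu; apply: b_le.
    have -> : d^-1 *: y + (1 - d^-1) *: x0 = x0 + d^-1 *: (y - x0).
      by apply/colP => i; rewrite !mxE; ring.
    apply: le_trans (norm2D _ _) _; rewrite lerD2l norm2Z.
    by rewrite ger0_norm ?invr_ge0 ?(ltW d0) // mulVf ?gt_eqF.
  move=> br'; have : d * b <= d * (d^-1 * r + (1 - d^-1) * g0).
    by rewrite ler_pM2l // (le_trans br').
  rewrite mulrDr mulrA mulfV ?gt_eqF // mul1r.
  rewrite [d * (_ * g0)]mulrA mulrBr mulr1 mulfV ?gt_eqF //.
  by lra.
set w := mu *: x0 - v; pose d0 := 2 * ((g0 - b) + norm2 w) / mu.
have d00 : 0 <= d0.
  by rewrite divr_ge0 ?(ltW mu0) // mulr_ge0 // addr_ge0 ?norm2_ge0 // subr_ge0.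
(* at a distance from x0 above 1 and d0, the quadratic term exceeds what g can
   lose along a ray, so that h >= h x0 there *)
have x0K : norm2 x0 <= norm2 x0 + 1 + d0 by lra.
have hx0 : (h x0 < +oo)%E by rewrite /h gx0E -EFinD ltry.
have [z _ zmin] := closed_fun_min (@compact_ball2 R c (norm2 x0 + 1 + d0)) hcl
  x0K hx0.
have phiD x e : phi (x + e) = phi x + dotv (mu *: x - v) e + mu / 2 * dotv e e.
  by rewrite /phi !dotv_lin (dotvC e x); field.
have {}zmin y : (h z <= h y)%E.
  have [yK|yK] := lerP (norm2 y) (norm2 x0 + 1 + d0); first exact: zmin.
  apply: le_trans (zmin _ x0K) _.
  have [gyoo|gyoo] := eqVneq (g y) +oo%E; first by rewrite /h gyoo leey.
  have gy : g y = (fine (g y))%:E by apply: fing; rewrite lt_neqAle gyoo leey.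
  rewrite /h gx0E gy -!EFinD lee_fin.
  set e := y - x0; have ye : y = x0 + e by rewrite addrC subrK.
  set d := norm2 e; have dd : d0 + 1 < d.
    rewrite -(ltrD2l (norm2 x0)) [d0 + 1]addrC addrA.
    by apply: lt_le_trans yK _; rewrite {1}ye norm2D.
  have := g_lb y _ gy; rewrite -/e -/d => /(_ _); have d1 : 1 < d by lra.
  move=> /(_ d1) lb.
  have cs : - (norm2 w * d) <= dotv w e.
    by have := CauchySchwarz (- w) e; rewrite norm2N dotvNl -/d; lra.
  rewrite {2}ye phiD -/w -norm2_sqr -/d.
  have e1 : (g0 - b) + norm2 w = mu / 2 * d0.
    by rewrite /d0; field; rewrite gt_eqF.
  have : 0 <= d * (mu / 2 * d - ((g0 - b) + norm2 w)).
    rewrite mulr_ge0 //; first lra.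
    rewrite e1 subr_ge0 ler_wpM2l //; last lra.
    by rewrite divr_ge0 // ltW.
  by lra.
have gz : g z = (fine (g z))%:E.
  apply: fing; have := le_lt_trans (zmin x0) hx0.
  by rewrite /h; have := gN z; case: (g z) => [r| |] //= _ _; exact: ltry.
exists z => y.
have [gyoo|gyoo] := eqVneq (g y) +oo%E; first by rewrite gyoo leey.
have gy : g y = (fine (g y))%:E by apply: fing; rewrite lt_neqAle gyoo leey.
rewrite gz gy -EFinD lee_fin; set a := fine _; set b' := fine _.
apply: (@le_of_le_addM_small _ _ (mu / 2 * dotv (y - z) (y - z))) => t t0 t1.
have [r gu rle] := convex_fun_real gp gc gy gz t0 t1.
have := zmin (t *: y + (1 - t) *: z).
rewrite /h gu gz -!EFinD lee_fin.
have -> : t *: y + (1 - t) *: z = z + t *: (y - z).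
  by apply/colP => i; rewrite !mxE; ring.
rewrite phiD !dotvZr !dotvZl -/a -/b' in rle *.
have -> : dotv (v - mu *: z) (y - z) = - dotv (mu *: z - v) (y - z).
  by rewrite -dotvNl opprB.
move: rle; rewrite -/a -/b'; set D := dotv _ (y - z); set E := dotv (y - z) _ => rle h1.
have : 0 <= t * ((b' - a) + D + t * (mu / 2 * E)).
  by nra.
by rewrite pmulr_rge0 //; lra.
Qed.

(** The descent lemma without differentiability: convexity of the defect
    [ell / 2 |.|^2 - G] along the line through [z] and [y], compared with the
    subgradient inequality just beyond [z], replaces the usual integration of
    the gradient. *)
Lemma descent (G : 'cV[R]_c -> R) (ell : R) z q :
  (forall x y t, 0 < t -> t < 1 ->
     ell / 2 * dotv (t *: x + (1 - t) *: y) (t *: x + (1 - t) *: y) -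
       G (t *: x + (1 - t) *: y) <=
     t * (ell / 2 * dotv x x - G x) + (1 - t) * (ell / 2 * dotv y y - G y)) ->
  (forall y, G z + dotv q (y - z) <= G y) ->
  forall y, G y <= G z + dotv q (y - z) + ell / 2 * dotv (y - z) (y - z).
Proof.
move=> Kc Gq y; set e := y - z.
have ye : y = z + e by rewrite /e addrC subrK.
clearbody e.
apply: (@le_of_le_addM_small _ _ (ell / 2 * dotv e e)) => t t0 t1.
have t1p : 0 < 1 + t by lra.
(* z is a convex combination of y and of the point z - t e beyond z on the same
   line; the subgradient inequality is used at the latter *)
pose a := (1 + t)^-1.
have aE : a * (1 + t) = 1 by rewrite /a mulVf // gt_eqF.
have a0 : 0 < a by rewrite invr_gt0.
have a1 : a < 1 by rewrite invf_lt1 //; lra.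
have := Kc (z - t *: e) y a a0 a1.
have -> : a *: (z - t *: e) + (1 - a) *: y = z.
  apply/colP => i; rewrite ye !mxE.
  transitivity (z i 0 + (1 - a - a * t) * e i 0); first by ring.
  by rewrite (_ : 1 - a - a * t = 0) ?mul0r ?addr0 //; lra.
have := Gq (z - t *: e); rewrite addrAC subrr add0r.
have -> : dotv y y = dotv z z + 2 * dotv z e + dotv e e.
  by rewrite ye !dotv_lin (dotvC e z); ring.
rewrite !dotv_lin (dotvC e z) => h1 h2.
have {}h2 := ler_wpM2l (ltW t1p) h2.
have combE X Y : (1 + t) * (a * X + (1 - a) * Y) = X + t * Y.
  transitivity ((a * (1 + t)) * X + (1 + t - a * (1 + t)) * Y); first by ring.
  by rewrite aE; ring.
rewrite combE in h2.
have {}h2 : t * G y <=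
    t * (G z + dotv q e + ell / 2 * dotv e e + t * (ell / 2 * dotv e e)).
  by nra.
by rewrite ler_pM2l in h2.
Qed.

End Convex.

(** * The function class *)

Section FunctionClass.
Context {R : realType} {s c : nat} (m : 'I_s -> R) (L : 'I_s -> \bar R).
Hypothesis m_lt_L : forall i, ((m i)%:E < L i)%E.

Lemma sigma_ge0 i : 0 <= sigma m L i.
Proof.
rewrite /sigma; have := m_lt_L i; case: (L i) => [l| |] //.
by rewrite lte_fin => ml; rewrite invr_ge0 subr_ge0 ltW.
Qed.

Lemma subdiffE (a : R) (f : 'cV[R]_c -> \bar R) z w :
  subdiff a f z w <-> csubdiff (shift_qf a f) z (w - a *: z).
Proof.
split=> [[v vz <-]|h]; first by rewrite addrK.
by exists (w - a *: z); rewrite ?subrK.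
Qed.

(** For [L i] finite this is the sharp inequality between subgradients of a
    convex function with [(L i - m i)]-Lipschitz gradient: minimise over [y]
    the gap between the quadratic upper bound at [z1] (descent lemma) and the
    linear lower bound at [z2]. *)
Lemma interpolation i (f : 'cV[R]_c -> \bar R) z1 z2 q1 q2 :
  Sclass (m i) (L i) f ->
  csubdiff (shift_qf (m i) f) z1 q1 -> csubdiff (shift_qf (m i) f) z2 q2 ->
  fine (shift_qf (m i) f z2) + dotv q2 (z1 - z2)
    + sigma m L i / 2 * dotv (q1 - q2) (q1 - q2)
  <= fine (shift_qf (m i) f z1).
Proof.
set g := shift_qf (m i) f => -[gpcc Lpcc] q1z1 q2z2.
have [gp gc _] := gpcc.
have g1 := csubdiff_fin gp q1z1; have g2 := csubdiff_fin gp q2z2.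
have := m_lt_L i; move: Lpcc; rewrite /sigma.
case: (L i) => [l| |] // => [|_ _]; last first.
  rewrite mul0r mul0r addr0 -lee_fin -g1 EFinD -g2; exact: q2z2.
move=> [[kN _] kc _]; rewrite lte_fin => ml.
have l0 : 0 < l - m i by rewrite subr_gt0.
have ffin y : f y = (fine (f y))%:E.
  have := kN y; have := gp.1 y; rewrite /g /shift_qf.
  by case: (f y).
pose G y := fine (g y).
have gE y : g y = (G y)%:E by rewrite /G /g /shift_qf ffin.
have GE y : G y = fine (f y) - m i * qf y by rewrite /G /g /shift_qf ffin.
have qfE y : qf y = 2^-1 * dotv y y by rewrite /qf norm2_sqr.
have G_sub z q : csubdiff g z q -> forall y, G z + dotv q (y - z) <= G y.
  by move=> h y; have := h y; rewrite !gE -EFinD lee_fin.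
have Kc x y t : 0 < t -> t < 1 ->
   (l - m i) / 2 * dotv (t *: x + (1 - t) *: y) (t *: x + (1 - t) *: y) -
       G (t *: x + (1 - t) *: y) <=
     t * ((l - m i) / 2 * dotv x x - G x) +
     (1 - t) * ((l - m i) / 2 * dotv y y - G y).
  move=> t0 t1; have := kc x y t t0 t1.
  rewrite (ffin x) (ffin y) (ffin (_ + _)) -!EFinB -!EFinM -EFinD lee_fin.
  by rewrite !GE !qfE; lra.
(* the minimiser of the gap between the two bounds *)
pose y := z1 - (l - m i)^-1 *: (q1 - q2).
have up := descent Kc (G_sub _ _ q1z1) y.
have lo := G_sub _ _ q2z2 y.
have yz1 : y - z1 = - ((l - m i)^-1 *: (q1 - q2)) by rewrite /y addrC addKr.
have yz2 : y - z2 = (z1 - z2) + - ((l - m i)^-1 *: (q1 - q2)).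
  by rewrite /y addrAC.
move: lo; rewrite yz2 => /le_trans/(_ up); rewrite yz1.
rewrite -/(G z1) -/(G z2); set a := (l - m i)^-1.
set d := q1 - q2.
have -> : (l - m i) / 2 * dotv (- (a *: d)) (- (a *: d)) = a / 2 * dotv d d.
  by rewrite !dotv_lin /a; field; rewrite gt_eqF.
have dd : dotv d d = dotv q1 d - dotv q2 d by rewrite -dotvBl.
rewrite (dotvDr (z1 - z2)) !dotvNr !dotvZr dd; clearbody a d.
by lra.
Qed.

(** The inverse of the subdifferential remains monotone after subtracting
    [sigma]: add [interpolation] to itself with the two points exchanged. *)
Lemma sigma_monotone i (f : 'cV[R]_c -> \bar R) z1 z2 q1 q2 :
  Sclass (m i) (L i) f ->
  csubdiff (shift_qf (m i) f) z1 q1 -> csubdiff (shift_qf (m i) f) z2 q2 ->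
  0 <= dotv (q1 - q2) ((z1 - z2) - sigma m L i *: (q1 - q2)).
Proof.
move=> fS h1 h2; have i1 := interpolation fS h1 h2.
have i2 := interpolation fS h2 h1.
rewrite (dotvBr (z1 - z2)) dotvZr (dotvBl q1 q2 (z1 - z2)).
move: i1 i2; rewrite -(opprB z1 z2) -(opprB q1 q2) !dotvNr dotvNl opprK.
by lra.
Qed.

(** The same operator has full-range resolvents for small steps; its resolvent
    equation is that of the subdifferential with rescaled data. *)
Lemma sigma_resolvent i (f : 'cV[R]_c -> \bar R) (tau : R) v :
  Sclass (m i) (L i) f -> 0 < tau -> tau * sigma m L i < 1 ->
  exists z q, csubdiff (shift_qf (m i) f) z q /\
    v = q + tau *: (z - sigma m L i *: q).
Proof.
move=> [gpcc _] t0; set sg := sigma m L i => t1.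
have a0 : 0 < 1 - tau * sg by rewrite subr_gt0.
have [z hz] := resolvent_exists ((1 - tau * sg)^-1 *: v) gpcc (divr_gt0 t0 a0).
exists z; eexists; split; first exact: hz.
apply/colP => j; rewrite !mxE.
by field; rewrite gt_eqF.
Qed.

End FunctionClass.

(** * Strongly monotone inclusions *)

Section Monotone.
Context {R : realType} {n : nat}.

(** In finite dimension no iteration is needed: the displacement of the
    contraction attains a minimum on an invariant ball, and one more
    application would decrease a positive minimum. *)
Lemma contraction_fixpoint (Phi : 'cV[R]_n -> 'cV[R]_n) (k : R) :
  0 <= k -> k < 1 ->
  (forall x y, norm2 (Phi x - Phi y) <= k * norm2 (x - y)) ->
  exists x, Phi x = x.
Proof.
move=> k0 k1 PhiL.
have k1' : 0 < 1 - k by rewrite subr_gt0.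
pose r := norm2 (Phi 0) / (1 - k).
have r0 : 0 <= r by rewrite divr_ge0 ?norm2_ge0 // ltW.
have rE : norm2 (Phi 0) = (1 - k) * r by rewrite /r mulrC divfK // gt_eqF.
pose f x := norm2 (Phi x - x).
have fc : continuous f.
  move=> x; apply: (@continuous_comp _ _ _ (fun x => Phi x - x) (@norm2 R n)).
    apply: (@lipschitz2_continuous _ _ _ _ (k + 1)); first by rewrite addr_ge0.
    move=> {}x y; have -> : Phi x - x - (Phi y - y) = (Phi x - Phi y) - (x - y).
      by rewrite !opprB addrACA [- x + _]addrC -addrACA; congr (_ + _); rewrite addrC.
    apply: le_trans (norm2D _ _) _; rewrite norm2N mulrDl mul1r.
    by rewrite lerD2r.
  exact: norm2_continuous.
have K0 : [set v : 'cV[R]_n | norm2 v <= r] !=set0.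
  by exists 0; rewrite /= norm2_0.
have [x] := compact_EVT_min K0 (@compact_ball2 R n r) (continuous_subspaceT fc).
rewrite inE /= => xr xmin; exists x.
have Phixr : norm2 (Phi x) <= r.
  rewrite -[Phi x](subrK (Phi 0)); apply: le_trans (norm2D _ _) _.
  have := PhiL x 0; rewrite subr0 rE => h.
  have := ler_wpM2l k0 xr; lra.
have := xmin _ (mem_set (Phixr : [set v : 'cV[R]_n | norm2 v <= r] (Phi x))).
rewrite /f => /le_trans/(_ (PhiL _ _)) h.
apply/eqP; rewrite -subr_eq0; apply/eqP/norm2_eq0.
have := norm2_ge0 (Phi x - x).
by rewrite le_eqVlt => /orP[/eqP <- //|p0]; exfalso; nra.
Qed.

Variables (T : 'cV[R]_n -> 'cV[R]_n -> Prop) (B : 'M[R]_n) (e : R).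
Hypothesis T_mono : forall q1 r1 q2 r2, T q1 r1 -> T q2 r2 ->
  0 <= dotv (q1 - q2) (r1 - r2).
Hypothesis e_gt0 : 0 < e.
Hypothesis B_strong : forall v, e * dotv v v <= dotv v (B *m v).

Lemma strongly_monotone_lipschitz q1 r1 q2 r2 : T q1 r1 -> T q2 r2 ->
  e * norm2 (q1 - q2) <= norm2 ((r1 + B *m q1) - (r2 + B *m q2)).
Proof.
move=> h1 h2; have mono := T_mono h1 h2; set d := q1 - q2.
have -> : r1 + B *m q1 - (r2 + B *m q2) = (r1 - r2) + B *m d.
  by rewrite /d mulmxBr opprD addrACA.
have := CauchySchwarz d ((r1 - r2) + B *m d).
rewrite dotvDr => cs; have := B_strong d; rewrite -norm2_sqr => bs.
have h : norm2 d * (e * norm2 d) <= norm2 d * norm2 (r1 - r2 + B *m d).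
  by rewrite -/d in mono; nra.
have := norm2_ge0 d; rewrite le_eqVlt => /orP[/eqP <-|d0].
  by rewrite mulr0 norm2_ge0.
by rewrite ler_pM2l in h.
Qed.

Variable tau0 : R.
Hypothesis tau0_gt0 : 0 < tau0.
Hypothesis T_resolvent : forall tau v, 0 < tau -> tau < tau0 ->
  exists q r, T q r /\ v = q + tau *: r.

(** Forward-backward splitting: for a small step, the explicit step on the
    strongly monotone Lipschitz part is a contraction and the resolvent of the
    monotone part is nonexpansive, whether or not [B] is symmetric. *)
Lemma strongly_monotone_surjective p : exists q r, T q r /\ r + B *m q = p.
Proof.
have [C C0 CB] := norm2_mulmx B.
have De : 0 < C ^+ 2 + e ^+ 2 by rewrite ltr_wpDl ?sqr_ge0 // exprn_gt0.
(* C bounds B, so that 1 - 2 tau e + tau^2 C^2 <= (1 - tau e / 2)^2 *)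
pose tau := Num.min (tau0 / 2) (e / (C ^+ 2 + e ^+ 2)).
have tau_gt0 : 0 < tau by rewrite lt_min !divr_gt0.
have tau_lt : tau < tau0.
  have : tau <= tau0 / 2 by rewrite ge_min lexx.
  by lra.
have tauD : tau * (C ^+ 2 + e ^+ 2) <= e.
  by rewrite -ler_pdivlMr // ge_min lexx orbT.
have te1 : tau * e <= 1.
  have h : e * (tau * e) <= e * 1 by nra.
  by rewrite ler_pM2l in h.
have /choice[J JP] : forall v, exists qr : 'cV[R]_n * 'cV[R]_n,
    T qr.1 qr.2 /\ v = qr.1 + tau *: qr.2.
  by move=> v; have [q [r h]] := T_resolvent v tau_gt0 tau_lt; exists (q, r).
pose Phi x := (J (x - tau *: (B *m x - p))).1.
have J_nonexp u v : norm2 ((J u).1 - (J v).1) <= 1 * norm2 (u - v).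
  apply: norm2_le => //; rewrite expr1n mul1r.
  have [Tu uE] := JP u; have [Tv vE] := JP v.
  have mono := T_mono Tu Tv.
  have -> : u - v = ((J u).1 - (J v).1) + tau *: ((J u).2 - (J v).2).
    by rewrite {1}uE {1}vE scalerBr opprD addrACA.
  move: mono; set a := _ - _; set b := _ - _ => mono.
  clearbody a b.
  rewrite !dotv_lin (dotvC b a).
  have := dotvv_ge0 b; have := mulr_ge0 (ltW tau_gt0) mono.
  by have := sqr_ge0 tau; nra.
have k0 : 0 <= 1 - tau * e / 2 by lra.
have k1 : 1 - tau * e / 2 < 1.
  by have := mulr_gt0 tau_gt0 e_gt0; lra.
have [x Phix] : exists x, Phi x = x.
  apply: (contraction_fixpoint k0 k1) => x y.
  apply: le_trans (J_nonexp _ _) _; rewrite mul1r.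
  apply: norm2_le => //.
  have -> : x - tau *: (B *m x - p) - (y - tau *: (B *m y - p)) =
      (x - y) - tau *: (B *m (x - y)).
    by rewrite mulmxBr; apply/colP => j; rewrite !mxE; ring.
  set d := x - y; clearbody d.
  have bs := B_strong d.
  have cb : dotv (B *m d) (B *m d) <= C ^+ 2 * dotv d d.
    by rewrite -!norm2_sqr -exprMn ler_pXn2r ?nnegrE ?mulr_ge0 ?norm2_ge0.
  rewrite !dotv_lin (dotvC (B *m d) d).
  have dd := dotvv_ge0 d.
  have h1 : tau * (e * dotv d d) <= tau * dotv d (B *m d) by rewrite ler_pM2l.
  have h2 : tau * (tau * dotv (B *m d) (B *m d)) <= tau * (tau * (C ^+ 2 * dotv d d)).
    by rewrite !ler_pM2l.
  have h3 : tau * (tau * (C ^+ 2) * dotv d d) <= tau * (e * dotv d d).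
    rewrite ler_pM2l // ler_wpM2r //; have := sqr_ge0 e; nra.
  have h4 := mulr_ge0 (sqr_ge0 (tau * e)) dd.
  by lra.
have [Tx xE] := JP (x - tau *: (B *m x - p)).
rewrite -/(Phi x) Phix in Tx xE.
exists x, (J (x - tau *: (B *m x - p))).2; split => //.
have : tau *: (J (x - tau *: (B *m x - p))).2 = tau *: (p - B *m x).
  have -> : tau *: (p - B *m x) = - (tau *: (B *m x - p)).
    by rewrite -scalerN opprB.
  by apply: (addrI x); rewrite -xE.
move/(scalerI (lt0r_neq0 tau_gt0)) => ->.
by rewrite subrK.
Qed.

End Monotone.

(** * Stacked vectors and block-diagonal gains *)

Section Blocks.
Context {R : realType} {s c : nat}.
Implicit Types (u v : 'cV[R]_(s * c)) (i : 'I_s).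

Lemma sum_mxtens (V : nmodType) (a b : nat) (F : 'I_(a * b) -> V) :
  \sum_x F x = \sum_(i < a) \sum_(k < b) F (mxtens_index (i, k)).
Proof.
rewrite pair_bigA /= (reindex (@mxtens_index a b)) /=.
  by apply: eq_bigr => -[i k] _.
by exists (@mxtens_unindex a b) => x _; rewrite (mxtens_indexK, mxtens_unindexK).
Qed.

Lemma blkD i u v : blk i (u + v) = blk i u + blk i v.
Proof. by apply/colP => k; rewrite !mxE. Qed.

Lemma blkZ i a u : blk i (a *: u) = a *: blk i u.
Proof. by apply/colP => k; rewrite !mxE. Qed.

Lemma blkB i u v : blk i (u - v) = blk i u - blk i v.
Proof. by apply/colP => k; rewrite !mxE. Qed.

Lemma blk_ext u v : (forall i, blk i u = blk i v) -> u = v.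
Proof.
move=> h; apply/colP => x; case: (mxtens_indexP x) => i k.
by have /colP/(_ k) := h i; rewrite !mxE.
Qed.

Definition stack (h : 'I_s -> 'cV[R]_c) : 'cV[R]_(s * c) :=
  \col_x h (mxtens_unindex x).1 (mxtens_unindex x).2 0.

Lemma blk_stack h i : blk i (stack h) = h i.
Proof. by apply/colP => k; rewrite !mxE mxtens_indexK. Qed.

Lemma dotv_blk u v : dotv u v = \sum_i dotv (blk i u) (blk i v).
Proof.
rewrite /dotv sum_mxtens; apply: eq_bigr => i _.
by apply: eq_bigr => k _; rewrite !mxE.
Qed.

Lemma blk_diagI (a : 'I_s -> R) i v : blk i (diagI c a *m v) = a i *: blk i v.
Proof.
apply/colP => k; rewrite !mxE sum_mxtens (bigD1 i) //= (bigD1 k) //=.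
rewrite !tensmxE !mxE !eqxx !mulr1n mulr1 !big1 ?addr0 // => [j ji|l lk].
  rewrite big1 // => l _.
  by rewrite tensmxE !mxE eq_sym (negPf ji) mulr0n !mul0r.
by rewrite tensmxE !mxE (eq_sym k) (negPf lk) mulr0 mul0r.
Qed.

Lemma onesIE i k l : onesI R s c (mxtens_index (i, k)) l = (k == l)%:R.
Proof.
rewrite /onesI castmxE /=.
have -> : cast_ord (esym (mul1n c)) l = mxtens_index (ord0, l) :> 'I_(1 * c).
  by apply: val_inj.
by rewrite cast_ord_id tensmxE !mxE mul1r.
Qed.

Lemma blk_onesI i (b : 'cV[R]_c) : blk i (onesI R s c *m b) = b.
Proof.
apply/colP => k; rewrite !mxE (bigD1 k) //= onesIE eqxx mul1r big1 ?addr0 //.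
by move=> l lk; rewrite onesIE eq_sym (negPf lk) mul0r.
Qed.

Lemma tr_onesI_mul v : (onesI R s c)^T *m v = \sum_i blk i v.
Proof.
apply/colP => k; rewrite !mxE sum_mxtens summxE; apply: eq_bigr => i _.
rewrite mxE (bigD1 k) //= mxE onesIE eqxx mul1r big1 ?addr0 //.
by move=> l lk; rewrite mxE onesIE (negPf lk) mul0r.
Qed.

End Blocks.

(** * The dissipation inequality *)

Section Dissipation.
Context {R : realType} {n p : nat} (G : ss R n p p) (M : 'M[R]_n).

Lemma LMI_quadratic_form x q :
  dotv (col_mx x q) (LMI_lhs G M *m col_mx x q) =
  dotv (ssA G *m x + ssB G *m q) (M *m (ssA G *m x + ssB G *m q))
  - dotv x (M *m x) + dotv (ssC G *m x + ssD G *m q) q.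
Proof.
rewrite /LMI_lhs mulmxDl -scalemxAl dotvDr dotvZr -!mulmxA.
rewrite ![dotv _ (_^T *m _)]dotv_mulmx !trmxK !mul_block_col !mul1mx.
rewrite !mul0mx !add0r !addr0.
rewrite !dotv_col mulNmx dotvNr (dotvC q); congr (_ + _).
by field.
Qed.

Lemma LMI_dissipation : negdef (LMI_lhs G M) ->
  exists2 e : R, 0 < e & forall x q,
    dotv (ssA G *m x + ssB G *m q) (M *m (ssA G *m x + ssB G *m q))
    + dotv (ssC G *m x + ssD G *m q) q + e * (dotv x x + dotv q q)
    <= dotv x (M *m x).
Proof.
move=> /posdef_coercive[e e0 h]; exists e => // x q.
have := h (col_mx x q); rewrite mulNmx dotvNr LMI_quadratic_form dotv_col.
by lra.
Qed.

End Dissipation.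

(** * Well-posedness *)

Section WellPosed.
Context {R : realType} {s c : nat} (m : 'I_s -> R) (L : 'I_s -> \bar R).
Hypothesis m_lt_L : forall i, ((m i)%:E < L i)%E.
Context (D : 'M[R]_(s * c)) (lam : 'I_s -> R) (e : R).
Hypothesis mD_unit : 1%:M - diagI c m *m D \in unitmx.
Hypothesis lam_gt0 : forall i, 0 < lam i.
Hypothesis e_gt0 : 0 < e.

(** [Q] is the direct feedthrough of the filtered interconnection, so that the
    hypothesis [Q_neg] is the lower right corner of the matrix inequality. *)
Let J := invmx (1%:M - diagI c m *m D).
Let Q := diagI c lam *m (D *m J - diagI c (sigma m L)).
Hypothesis Q_neg : forall v, e * dotv v v <= dotv v (- Q *m v).

Lemma loop_inputE (p z w q : 'cV[R]_(s * c)) :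
  z = p + D *m w -> w = q + diagI c m *m z ->
  w = J *m (q + diagI c m *m p).
Proof.
move=> zE wE.
have : (1%:M - diagI c m *m D) *m w = q + diagI c m *m p.
  by rewrite mulmxBl mul1mx -mulmxA {1}wE zE mulmxDr addrA addrK.
by move=> <-; rewrite mulKmx.
Qed.

Lemma inv_loopE (q p : 'cV[R]_(s * c)) : let w := J *m (q + diagI c m *m p) in
  w = q + diagI c m *m (p + D *m w).
Proof.
move=> w; have : (1%:M - diagI c m *m D) *m w = q + diagI c m *m p.
  by rewrite /w mulKVmx.
by rewrite mulmxBl mul1mx mulmxDr mulmxA addrA => <-; rewrite subrK.
Qed.

Variable f : 'I_s -> 'cV[R]_c -> \bar R.
Hypothesis fS : forall i, Sclass (m i) (L i) (f i).

(** The inverse of the stacked subdifferential, minus [sigma], with block [i]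
    weighted by [lam i]. The weights keep it monotone because it acts
    blockwise, and make the coupling through [D] strongly monotone. *)
Let T (q r : 'cV[R]_(s * c)) := exists z, (forall i,
  csubdiff (shift_qf (m i) (f i)) (blk i z) (blk i q)) /\
  r = diagI c lam *m (z - diagI c (sigma m L) *m q).

Let F : operator R (s * c) :=
  fun z => [set w | forall i, subdiff (m i) (f i) (blk i z) (blk i w)].

Lemma T_monotone q1 r1 q2 r2 : T q1 r1 -> T q2 r2 ->
  0 <= dotv (q1 - q2) (r1 - r2).
Proof.
move=> [z1 [h1 ->]] [z2 [h2 ->]]; rewrite -mulmxBr dotv_blk.
apply: sumr_ge0 => i _; rewrite blk_diagI dotvZr.
apply: mulr_ge0; first exact/ltW/lam_gt0.
rewrite !blkB !blk_diagI opprD addrACA -opprD -scalerBr.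
exact: sigma_monotone (h1 i) (h2 i).
Qed.

Lemma T_resolvent : exists2 tau0 : R, 0 < tau0 &
  forall tau v, 0 < tau -> tau < tau0 -> exists q r, T q r /\ v = q + tau *: r.
Proof.
pose S := 1 + \sum_i lam i * sigma m L i.
have Si i : lam i * sigma m L i < S.
  rewrite /S (bigD1 i) //= addrCA ltrDl ltr_pwDl // sumr_ge0 // => j _.
  by apply: mulr_ge0; [exact/ltW|exact: sigma_ge0].
have S0 : 0 < S.
  rewrite ltr_pwDl // sumr_ge0 // => j _.
  by apply: mulr_ge0; [exact/ltW|exact: sigma_ge0].
exists S^-1; first by rewrite invr_gt0.
move=> tau v t0 tS.
have tSi i : tau * lam i * sigma m L i < 1.
  rewrite -mulrA; apply: lt_trans (_ : tau * S < _).
    by rewrite ltr_pM2l.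
  by rewrite -ltr_pdivlMr // mul1r.
have /choice[zq zqP] : forall i, exists zq : 'cV[R]_c * 'cV[R]_c,
    csubdiff (shift_qf (m i) (f i)) zq.1 zq.2 /\
    blk i v = zq.2 + (tau * lam i) *: (zq.1 - sigma m L i *: zq.2).
  move=> i; have [z [q h]] := sigma_resolvent (blk i v) (fS i)
    (mulr_gt0 t0 (lam_gt0 i)) (tSi i).
  by exists (z, q).
pose q := stack (fun i => (zq i).2); pose z := stack (fun i => (zq i).1).
exists q, (diagI c lam *m (z - diagI c (sigma m L) *m q)); split.
  by exists z; split => // i; rewrite !blk_stack; have [] := zqP i.
apply: blk_ext => i; rewrite blkD blkZ blk_diagI blkB blk_diagI !blk_stack.
by rewrite scalerA; have [] := zqP i.
Qed.

(** The loop equation [z = p + D w], [w] in [F z], written in the variables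
    [q = w - m z]: an inclusion with the strongly monotone matrix [- Q]. *)
Lemma loop_inclusion p z w : let q := w - diagI c m *m z in
  F z w -> z = p + D *m w ->
  exists2 r, T q r & r + - Q *m q = diagI c lam *m (p + D *m J *m diagI c m *m p).
Proof.
move=> q Fzw zE.
exists (diagI c lam *m (z - diagI c (sigma m L) *m q)).
  exists z; split => // i; have /subdiffE := Fzw i.
  by rewrite blkB blk_diagI.
have wE : w = J *m (q + diagI c m *m p).
  by apply: loop_inputE zE _; rewrite /q subrK.
rewrite mulNmx /Q -(mulmxA (diagI c lam)) -mulmxBr; congr (_ *m _).
have zE' : z = p + D *m (J *m (q + diagI c m *m p)) by rewrite -wE.
rewrite mulmxBl opprB addrA subrK zE' !mulmxDr !mulmxA.
by rewrite [X in p + X]addrC addrA addrK.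
Qed.

(** The inclusion of [loop_inclusion] has a solution [q]; the [z] that comes
    with it satisfies the loop equation because the weights are invertible. *)
Lemma loop_solvable p : exists w, F (p + D *m w) w.
Proof.
have [tau0 tau00 res] := T_resolvent.
have [q [r [[z [zq ->]] qE]]] := strongly_monotone_surjective T_monotone e_gt0
  Q_neg tau00 res (diagI c lam *m (p + D *m J *m diagI c m *m p)).
pose w := J *m (q + diagI c m *m p).
have zE : z = p + D *m w.
  apply: blk_ext => i; apply: (scalerI (lt0r_neq0 (lam_gt0 i))).
  rewrite -!blk_diagI.
  move: qE; rewrite mulNmx /Q -(mulmxA (diagI c lam)) -mulmxBr => /(congr1 (blk i)).
  rewrite !blk_diagI => /(scalerI (lt0r_neq0 (lam_gt0 i))).
  rewrite mulmxBl opprB addrA subrK !blkB !blkD => /eqP.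
  rewrite subr_eq => /eqP ->; rewrite /w !mulmxDr !mulmxA !blkD.
  by rewrite -addrA [X in _ + X]addrC.
exists w => i; apply/subdiffE; rewrite -blk_diagI -blkB -zE.
suff -> : w - diagI c m *m z = q by [].
by rewrite {1}/w (inv_loopE q p) -/w -zE addrK.
Qed.

Lemma loop_lipschitz : exists2 C : R, 0 <= C & forall p1 p2 w1 w2,
  F (p1 + D *m w1) w1 -> F (p2 + D *m w2) w2 ->
  norm2 (w1 - w2) <= C * norm2 (p1 - p2).
Proof.
pose X := diagI c lam *m (1%:M + D *m J *m diagI c m).
have [C1 C10 C1P] := norm2_mulmx X.
have [C2 C20 C2P] := norm2_mulmx J.
have [C3 C30 C3P] := norm2_mulmx (diagI c m).
exists (C2 * (C1 / e + C3)).
  by rewrite mulr_ge0 // addr_ge0 // divr_ge0 // ltW.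
move=> p1 p2 w1 w2 F1 F2.
have [r1 T1 E1] := loop_inclusion F1 erefl.
have [r2 T2 E2] := loop_inclusion F2 erefl.
have := strongly_monotone_lipschitz T_monotone Q_neg T1 T2.
rewrite E1 E2 -mulmxBr.
have -> : p1 + D *m J *m diagI c m *m p1 - (p2 + D *m J *m diagI c m *m p2) =
    (1%:M + D *m J *m diagI c m) *m (p1 - p2).
  by rewrite mulmxDl mul1mx mulmxBr opprD addrACA.
rewrite mulmxA => /le_trans/(_ (C1P _)).
set q1 := w1 - diagI c m *m _; set q2 := w2 - diagI c m *m _ => h.
have w1E : w1 = J *m (q1 + diagI c m *m p1).
  by apply: loop_inputE erefl _; rewrite /q1 subrK.
have w2E : w2 = J *m (q2 + diagI c m *m p2).
  by apply: loop_inputE erefl _; rewrite /q2 subrK.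
rewrite w1E w2E -mulmxBr opprD addrACA -mulmxBr.
apply: le_trans (C2P _) _; rewrite -mulrA ler_wpM2l //.
apply: le_trans (norm2D _ _) _; rewrite mulrDl lerD //.
by rewrite mulrAC ler_pdivlMr // mulrC.
Qed.

Lemma loop_well_posed :
  globally_continuous (op_inv (op_sub_mx (op_inv F) D)).
Proof.
have [C C0 CP] := loop_lipschitz.
have /choice[g gP] := loop_solvable.
exists g; split.
  by apply: (lipschitz2_continuous C0) => x y; apply: CP.
move=> p; apply/seteqP; split=> [w [z Fzw pE]|_ ->]; rewrite /op_inv /op_sub_mx /=.
  have Fw : F (p + D *m w) w by rewrite -pE subrK.
  apply/eqP; rewrite -subr_eq0; apply/eqP/norm2_eq0/le_anti.
  by rewrite norm2_ge0 andbT (le_trans (CP _ _ _ _ Fw (gP p))) // subrr norm2_0 mulr0.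
by exists (p + D *m g p); [exact: gP | rewrite addrK].
Qed.

End WellPosed.

(** * The delay-line filter *)

Section Filter.
Context {R : realType} {s c nmax : nat} (lam : 'I_s -> 'I_nmax.+1 -> R).
Variable p : nat -> 'cV[R]_(s * c).

Definition delayed (k nu : nat) : 'cV[R]_(s * c) :=
  if (nu <= k)%N then p (k - nu)%N else 0.

(** The contents of the shift registers at time [k], in closed form; [filter_state0],
    [filter_stateS] and [filter_output] identify it with the zero-initialised
    state of [Psi]. *)
Definition filter_state (k : nat) : 'cV[R]_(s * (nmax * c)) :=
  \col_x let: (i, y) := mxtens_unindex x in
         let: (a, l) := mxtens_unindex y in
         delayed k a.+1 (mxtens_index (i, l)) 0.

Lemma filter_stateE k i a l :
  filter_state k (mxtens_index (i, mxtens_index (a, l))) 0 =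
  delayed k a.+1 (mxtens_index (i, l)) 0.
Proof. by rewrite mxE !mxtens_indexK. Qed.

Lemma filter_state0 : filter_state 0 = 0.
Proof.
apply/colP => x; case: (mxtens_indexP x) => i y; case: (mxtens_indexP y) => a l.
by rewrite filter_stateE !mxE.
Qed.

Lemma tens1mxE (a b : nat) (B : 'M[R]_(a, b)) (v : 'cV[R]_(s * b)) i x :
  (((1%:M : 'M[R]_s) *t B) *m v) (mxtens_index (i, x)) 0 =
  \sum_y B x y * v (mxtens_index (i, y)) 0.
Proof.
rewrite mxE sum_mxtens (bigD1 i) //= [X in _ + X]big1 ?addr0 => [|j ji].
  by apply: eq_bigr => y _; rewrite tensmxE mxE eqxx mul1r.
by rewrite big1 // => y _; rewrite tensmxE mxE eq_sym (negPf ji) !mul0r.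
Qed.

Lemma sum_delta (a : nat) (k : 'I_a) (F : 'I_a -> R) :
  \sum_l (k == l)%:R * F l = F k.
Proof.
rewrite (bigD1 k) //= eqxx mul1r big1 ?addr0 // => l lk.
by rewrite eq_sym (negPf lk) mul0r.
Qed.

Lemma filter_stateS k : filter_state k.+1 =
  ssA (Psi c lam) *m filter_state k + ssB (Psi c lam) *m p k.
Proof.
apply/colP => x; case: (mxtens_indexP x) => i y; case: (mxtens_indexP y) => a l.
rewrite filter_stateE [RHS]mxE /= !tens1mxE sum_mxtens.
have -> : \sum_(b < nmax) \sum_(l' < c)
    ((\matrix_(a, b) ((a : nat) == b.+1)%:R : 'M[R]_nmax) *t (1%:M : 'M[R]_c))
      (mxtens_index (a, l)) (mxtens_index (b, l')) *
    filter_state k (mxtens_index (i, mxtens_index (b, l'))) 0 =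
    \sum_(b < nmax) ((a : nat) == b.+1)%:R * delayed k b.+1 (mxtens_index (i, l)) 0.
  apply: eq_bigr => b _.
  under eq_bigr => l' _ do rewrite tensmxE filter_stateE !mxE -mulrA mulrCA.
  by rewrite (sum_delta l).
have -> : \sum_(y < c)
    castmx (erefl (nmax * c)%N, mul1n c)
      ((\col_a ((a : nat) == 0%N)%:R : 'cV[R]_nmax) *t (1%:M : 'M[R]_c))
      (mxtens_index (a, l)) y * p k (mxtens_index (i, y)) 0 =
    ((a : nat) == 0%N)%:R * p k (mxtens_index (i, l)) 0.
  under eq_bigr => l' _.
    rewrite castmxE /= cast_ord_id.
    have -> : cast_ord (esym (mul1n c)) l' = mxtens_index (ord0, l') :> 'I_(1 * c).
      by apply: val_inj.
    rewrite tensmxE !mxE -mulrA mulrCA; over.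
  by rewrite (sum_delta l).
case: a => [[|a] aN] /=.
  rewrite big1 ?add0r ?mul1r; last by move=> b _; rewrite mul0r.
  by rewrite /delayed /= subn1.
rewrite mul0r addr0 (bigD1 (Ordinal (ltnW aN))) //= eqxx mul1r big1 ?addr0.
  by rewrite /delayed ltnS subSS.
move=> b ba; rewrite (_ : (a.+1 == b.+1) = false) ?mul0r //.
by apply/negP => /eqP[ab]; case/negP: ba; apply/eqP/val_inj.
Qed.

Lemma Psi_CE i k j a l :
  ssC (Psi c lam) (mxtens_index (i, k)) (mxtens_index (j, mxtens_index (a, l))) =
  ((i == j) && (k == l))%:R * lam i (lift ord0 a).
Proof. by rewrite mxE !mxtens_indexK. Qed.

Lemma filter_output k i :
  blk i (ssC (Psi c lam) *m filter_state k + ssD (Psi c lam) *m p k) =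
  \sum_nu lam i nu *: blk i (delayed k nu).
Proof.
rewrite blkD blk_diagI big_ord_recl addrC.
have -> : delayed k (@ord0 nmax) = p k by rewrite /delayed leq0n subn0.
congr (_ + _); apply/colP => l; rewrite summxE [LHS]mxE [LHS]mxE sum_mxtens.
rewrite (bigD1 i) //= [X in _ + X]big1 ?addr0 => [|j ji].
  rewrite sum_mxtens; apply: eq_bigr => a _.
  under eq_bigr => l' _ do rewrite filter_stateE Psi_CE eqxx andTb -mulrA.
  by rewrite (sum_delta l) !mxE.
rewrite sum_mxtens big1 // => a _; rewrite big1 // => l' _.
by rewrite Psi_CE eq_sym (negPf ji) !mul0r.
Qed.

End Filter.

(** * Weighted sums of supplies and storages *)

Section Multiplier.
Context {R : realType} {nmax : nat} (lam : 'I_nmax.+1 -> R) (rho : R).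
Hypotheses (rho_gt0 : 0 < rho) (rho_lt1 : rho < 1).
Hypothesis lam_sum : 0 < \sum_(nu < nmax.+1) rho ^- nu * lam nu.
Hypothesis lam_le0 : forall nu : 'I_nmax.+1, (1 <= nu)%N -> lam nu <= 0.

Lemma lam0_gt0 : 0 < lam ord0.
Proof.
move: lam_sum; rewrite big_ord_recl /= expr0 invr1 mul1r => h.
apply: lt_le_trans h _; rewrite gerDl; apply: sumr_le0 => nu _.
by rewrite mulr_ge0_le0 ?lam_le0 // invr_ge0 exprn_ge0 // ltW.
Qed.

Lemma sum_shift (y : nat -> R) nu T :
  \sum_(k < T) (if (nu <= k)%N then y (k - nu)%N else 0) =
  \sum_(j < T - nu) y j.
Proof.
elim: T => [|T IH]; first by rewrite sub0n !big_ord0.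
rewrite big_ord_recr /= IH; case: leqP => h.
  by rewrite subSn // big_ord_recr.
by rewrite addr0; move: (h) => /ltnW; rewrite -!subn_eq0 => /eqP ->;
  move: h; rewrite -subn_eq0 => /eqP ->.
Qed.

(** Every [y j] is counted once with each weight, except that the delayed ones,
    which are nonpositive, may be missing for [j] close to [T]: the sum is at
    least the total weight times the sum of the [y j]. *)
Lemma weighted_delay_sum_ge0 (y : nat -> R) T : (forall k, 0 <= y k) ->
  0 <= \sum_(k < T) \sum_(nu < nmax.+1)
         (if (nu <= k)%N then rho ^- nu * lam nu * y (k - nu)%N else 0).
Proof.
move=> y0; pose Y := \sum_(k < T) y k.
have Y0 : 0 <= Y by apply: sumr_ge0.
apply: le_trans (mulr_ge0 (ltW lam_sum) Y0) _.
rewrite exchange_big mulr_suml; apply: ler_sum => nu _.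
have -> : \sum_(k < T)
    (if (nu <= k)%N then rho ^- nu * lam nu * y (k - nu)%N else 0) =
    rho ^- nu * lam nu * \sum_(j < T - nu) y j.
  rewrite -sum_shift mulr_sumr; apply: eq_bigr => k _.
  by case: ifP => _ //; rewrite mulr0.
have [nu0|nu1] := posnP nu; first by rewrite nu0 subn0.
rewrite ler_wnM2l //.
  by rewrite mulr_ge0_le0 ?lam_le0 // invr_ge0 exprn_ge0 // ltW.
rewrite /Y -!(big_mkord xpredT y) [leRHS](@big_cat_nat _ _ _ (T - nu)) ?leq_subr //=.
by rewrite lerDl sumr_ge0.
Qed.

(** Here [a k j] is the supply of the input at time [k] against the output at
    time [j], and [phi] the storage. In the excess [a k j - phi j] the undelayed
    value dominates, and its weight dominates the damped delayed weights
    [rho ^+ nu * lam nu]; so the supplies are at least the storages with the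
    same weights, whose sum is nonnegative by [weighted_delay_sum_ge0]. *)
Lemma weighted_supply_ge0 (a : nat -> nat -> R) (phi : nat -> R) T :
  (forall k, 0 <= phi k) -> (forall k, phi k <= a k k) ->
  (forall k j, phi k - phi j <= a k k - a k j) ->
  0 <= \sum_(k < T) \sum_(nu < nmax.+1)
         (if (nu <= k)%N
          then lam nu * (rho ^- (k - nu) * (rho ^- k * a k (k - nu)%N)) else 0).
Proof.
move=> phi0 phia phid.
have r0 k : 0 <= rho ^- k by rewrite invr_ge0 exprn_ge0 // ltW.
have rn0 : rho != 0 by rewrite gt_eqF.
have key := @weighted_delay_sum_ge0 (fun j => rho ^- j * (rho ^- j * phi j)) T
  (fun k => mulr_ge0 (r0 k) (mulr_ge0 (r0 k) (phi0 k))).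
apply: le_trans key _; apply: ler_sum => k _; rewrite -subr_ge0 -sumrB.
(* the excess of the undelayed term *)
pose b := a k k - phi k.
have b0 : 0 <= b by rewrite subr_ge0.
pose W := rho ^- k * rho ^- k * b.
have W0 : 0 <= W by rewrite !mulr_ge0.
apply: (@le_trans _ _ (\sum_(nu < nmax.+1) rho ^- nu * lam nu * W)).
  by rewrite -mulr_suml mulr_ge0 // ltW.
apply: ler_sum => nu _.
have lam_nonpos : (0 < nu)%N -> rho ^- nu * lam nu <= 0.
  by move=> nu1; rewrite mulr_ge0_le0 ?lam_le0.
case: leqP => [nuk|kn]; last first.
  rewrite subrr mulr_le0_ge0 // lam_nonpos //.
  exact: leq_ltn_trans (leq0n k) kn.
have E : rho ^- (k - nu) = rho ^+ nu * rho ^- k.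
  by rewrite -[in RHS](subnK nuk) exprD invfM mulrCA mulfV ?mulr1 // expf_neq0.
have E' : rho ^- nu * rho ^- (k - nu) = rho ^- k.
  by rewrite -invfM -exprD subnKC.
set A := a _ _; set F := phi (k - nu)%N.
have -> : lam nu * (rho ^- (k - nu) * (rho ^- k * A)) -
    rho ^- nu * lam nu * (rho ^- (k - nu) * (rho ^- (k - nu) * F)) =
    rho ^+ nu * lam nu * (rho ^- k * rho ^- k * (A - F)).
  rewrite (_ : rho ^- nu * lam nu * _ =
    lam nu * (rho ^- nu * rho ^- (k - nu)) * (rho ^- (k - nu) * F)); last by ring.
  by rewrite E' E; ring.
have [nu0|nu1] := posnP nu.
  have -> : A - F = b by rewrite /A /F nu0 subn0.
  by rewrite nu0 expr0 invr1.
have AFb : A - F <= b by have := phid k (k - nu)%N; rewrite /b -/A -/F; lra.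
have Pn0 : 0 <= rho ^+ nu by rewrite exprn_ge0 // ltW.
apply: (@le_trans _ _ (rho ^+ nu * lam nu * W)).
  rewrite ler_wpM2r // ler_wnM2r ?lam_le0 //.
  apply: (@le_trans _ _ 1); first by rewrite exprn_ile1 // ltW.
  by rewrite invf_ge1 ?exprn_gt0 // exprn_ile1 // ltW.
rewrite /W ler_wnM2l //; first by rewrite mulr_ge0_le0 ?lam_le0.
by rewrite ler_wpM2l // mulr_ge0.
Qed.

End Multiplier.

(** * Storage functions of the nonlinearity *)

Section Storage.
Context {R : realType} {s c : nat} (m : 'I_s -> R) (L : 'I_s -> \bar R).
Hypothesis m_lt_L : forall i, ((m i)%:E < L i)%E.
Context (i : 'I_s) (f : 'cV[R]_c -> \bar R).
Hypothesis fS : Sclass (m i) (L i) f.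
Context (zs qs : 'cV[R]_c).
Hypothesis zqs : csubdiff (shift_qf (m i) f) zs qs.

Let g x := fine (shift_qf (m i) f x).
Let p (z q : 'cV[R]_c) := (z - zs) - sigma m L i *: (q - qs).

(** The Bregman distance of the shifted function from the equilibrium, minus
    the part that the bound on the curvature supplies. *)
Definition storage (z q : 'cV[R]_c) : R :=
  g z - g zs - dotv qs (z - zs) - sigma m L i / 2 * dotv (q - qs) (q - qs).

Lemma storage_ge0 z q : csubdiff (shift_qf (m i) f) z q -> 0 <= storage z q.
Proof.
move=> zq; have := interpolation m_lt_L fS zq zqs.
by rewrite /storage /g; lra.
Qed.

(** [interpolation] between two points of a trajectory: its quadratic term is
    what turns the outputs [z] into [z - sigma q]. *)
Lemma storage_diff z1 q1 z2 q2 :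
  csubdiff (shift_qf (m i) f) z1 q1 -> csubdiff (shift_qf (m i) f) z2 q2 ->
  storage z1 q1 - storage z2 q2 <=
  dotv (q1 - qs) (p z1 q1) - dotv (q1 - qs) (p z2 q2).
Proof.
move=> h1 h2; have := interpolation m_lt_L fS h2 h1.
rewrite /storage -!/(g _).
have -> : q2 - q1 = (q2 - qs) - (q1 - qs) by rewrite opprB addrA subrK.
have -> : z2 - z1 = (z2 - zs) - (z1 - zs) by rewrite opprB addrA subrK.
have {1}-> : q1 = (q1 - qs) + qs by rewrite subrK.
rewrite /p; move: (q1 - qs) (q2 - qs) (z1 - zs) (z2 - zs) => a b x y.
rewrite !dotv_lin (dotvC b a); lra.
Qed.

Lemma storage_le z q : csubdiff (shift_qf (m i) f) z q ->
  storage z q <= dotv (q - qs) (p z q).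
Proof.
move=> zq; have := storage_diff zq zqs.
rewrite {2}/storage /p !subrr scaler0 subr0 !dotv0r; lra.
Qed.

End Storage.

(** The energy [V] stays nonnegative and the multiplier sums [r] are
    nonnegative, so the dissipated amount at any single time is at most the
    initial energy. *)
Lemma dissipation_bound (R : realType) (V r E : nat -> R) :
  (forall k, V k.+1 + r k + E k <= V k) -> (forall k, 0 <= V k) ->
  (forall k, 0 <= E k) -> (forall T : nat, 0 <= \sum_(k < T) r k) ->
  forall k, E k <= V 0%N.
Proof.
move=> step V0 E0 r0 k.
have sum T : V T + \sum_(j < T) r j + \sum_(j < T) E j <= V 0%N.
  elim: T => [|T IH]; first by rewrite !big_ord0 !addr0.
  by have := step T; rewrite !big_ord_recr /=; lra.
have := sum k.+1; have := r0 k.+1; rewrite (big_ord_recr _ E) /=.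
have := V0 k.+1; have : 0 <= \sum_(j < k) E j by apply: sumr_ge0.
by lra.
Qed.

(** * Exponential bound along trajectories *)

Section ExponentialBound.
Context {R : realType} {s c n nmax : nat} (m : 'I_s -> R) (L : 'I_s -> \bar R).
Hypothesis m_lt_L : forall i, ((m i)%:E < L i)%E.
Context (rho : R) (S : ss R n (s * c) (s * c)).
Hypotheses (rho_gt0 : 0 < rho) (rho_lt1 : rho < 1).
Hypothesis mD_unit : 1%:M - diagI c m *m ssD S \in unitmx.

Let F (f : 'I_s -> 'cV[R]_c -> \bar R) : operator R (s * c) :=
  fun z => [set w | forall i, subdiff (m i) (f i) (blk i z) (blk i w)].

(** The loop transformation: in the input [w - m z], the closed loop is the
    realisation of the transformed system. *)
Lemma SigmaG_step (x : 'cV[R]_n) (w z : 'cV[R]_(s * c)) :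
  let q := w - diagI c m *m z in
  z = ssC S *m x + ssD S *m w ->
  [/\ rho^-1 *: (ssA S *m x + ssB S *m w) =
        ssA (SigmaG m L rho S) *m x + ssB (SigmaG m L rho S) *m q,
      z - diagI c (sigma m L) *m q =
        ssC (SigmaG m L rho S) *m x + ssD (SigmaG m L rho S) *m q
    & w = invmx (1%:M - diagI c m *m ssD S) *m (q + diagI c m *m (ssC S *m x))].
Proof.
move=> q zE.
have wE : w = invmx (1%:M - diagI c m *m ssD S) *m (q + diagI c m *m (ssC S *m x)).
  by apply: (loop_inputE mD_unit zE); rewrite /q subrK.
clearbody q; split => //=.
- rewrite -!scalemxAl -scalerDr {1}wE mulmxDl !mulmxDr !mulmxA -addrA.
  by rewrite [X in _ *: (_ + X)]addrC.
- rewrite {1}zE {1}wE !mulmxDl mulNmx !mulmxDr !mulmxA -!addrA.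
  by congr (_ + _); rewrite addrCA.
Qed.

Lemma GPsi_step (lam : 'I_s -> 'I_nmax.+1 -> R) (x : 'cV[R]_n)
    (q : 'cV[R]_(s * c)) (psi : 'cV[R]_(s * (nmax * c))) :
  let p := ssC (SigmaG m L rho S) *m x + ssD (SigmaG m L rho S) *m q in
  ssA (GPsi m L rho S lam) *m col_mx x psi + ssB (GPsi m L rho S lam) *m q =
    col_mx (ssA (SigmaG m L rho S) *m x + ssB (SigmaG m L rho S) *m q)
           (ssA (Psi c lam) *m psi + ssB (Psi c lam) *m p) /\
  ssC (GPsi m L rho S lam) *m col_mx x psi + ssD (GPsi m L rho S lam) *m q =
    ssC (Psi c lam) *m psi + ssD (Psi c lam) *m p.
Proof.
rewrite /GPsi /series_conn; move: (SigmaG m L rho S) (Psi c lam) => G1 G2 /=.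
split.
- rewrite mul_block_col mul_col_mx add_col_mx mul0mx addr0.
  by congr col_mx; rewrite mulmxDr !mulmxA addrAC addrC.
- by rewrite mul_row_col mulmxDr !mulmxA addrAC addrC.
Qed.

Variables (lam : 'I_s -> 'I_nmax.+1 -> R).
Hypothesis lam_sum : forall i, 0 < \sum_(nu < nmax.+1) rho ^- nu * lam i nu.
Hypothesis lam_le0 : forall i (nu : 'I_nmax.+1), (1 <= nu)%N -> lam i nu <= 0.

Section Trajectory.
Variables (f : 'I_s -> 'cV[R]_c -> \bar R).
Hypothesis fS : forall i, Sclass (m i) (L i) (f i).
Variables (xs : 'cV[R]_n) (ws zs : 'cV[R]_(s * c)).
Hypothesis fixed : fixed_point (F f) S xs ws zs.
Variables (x : nat -> 'cV[R]_n) (w z : nat -> 'cV[R]_(s * c)).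
Hypothesis traj : trajectory (F f) S x w z.

Let qof (w z : 'cV[R]_(s * c)) := w - diagI c m *m z.
(** Deviations from the equilibrium, scaled by [rho ^- k]: exponential decay of
    the trajectory is boundedness of these. *)
Definition xbar k := rho ^- k *: (x k - xs).
Definition wbar k := rho ^- k *: (w k - ws).
Definition zbar k := rho ^- k *: (z k - zs).
Definition qbar k := wbar k - diagI c m *m zbar k.
Definition pbar k := zbar k - diagI c (sigma m L) *m qbar k.
Definition xhat k := col_mx (xbar k) (@filter_state R s c nmax pbar k).
Definition rbar k :=
  ssC (Psi c lam) *m @filter_state R s c nmax pbar k + ssD (Psi c lam) *m pbar k.

Lemma zbarE k : zbar k = ssC S *m xbar k + ssD S *m wbar k.
Proof.
have [_ zE _] := traj k; have [_ zsE _] := fixed.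
rewrite /zbar zE zsE -!scalemxAr -scalerDr !mulmxBr.
by rewrite opprD addrACA.
Qed.

Lemma xbarS k : xbar k.+1 = rho^-1 *: (ssA S *m xbar k + ssB S *m wbar k).
Proof.
have [xE _ _] := traj k; have [xsE _ _] := fixed.
rewrite /xbar xE {1}xsE -!scalemxAr -scalerDr scalerA -invfM -exprS !mulmxBr.
by rewrite opprD addrACA.
Qed.

Lemma xhatS k : xhat k.+1 =
  ssA (GPsi m L rho S lam) *m xhat k + ssB (GPsi m L rho S lam) *m qbar k.
Proof.
have [xE pE _] := SigmaG_step (zbarE k).
have [-> _] := GPsi_step lam (xbar k) (qbar k) (@filter_state R s c nmax pbar k).
by rewrite /xhat xbarS xE -pE (filter_stateS lam).
Qed.

Lemma rbarE k : rbar k =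
  ssC (GPsi m L rho S lam) *m xhat k + ssD (GPsi m L rho S lam) *m qbar k.
Proof.
have [_ pE _] := SigmaG_step (zbarE k).
have [_ ->] := GPsi_step lam (xbar k) (qbar k) (@filter_state R s c nmax pbar k).
by rewrite -pE.
Qed.

Lemma subgradient i k :
  csubdiff (shift_qf (m i) (f i)) (blk i (z k)) (blk i (qof (w k) (z k))).
Proof.
have [_ _ Fzw] := traj k; have /subdiffE := Fzw i.
by rewrite /qof blkB blk_diagI.
Qed.

Lemma subgradient_fixed i :
  csubdiff (shift_qf (m i) (f i)) (blk i zs) (blk i (qof ws zs)).
Proof.
have [_ _ Fzw] := fixed; have /subdiffE := Fzw i.
by rewrite /qof blkB blk_diagI.
Qed.

(** The integral quadratic constraint on the nonlinearity, block by block from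
    [weighted_supply_ge0]. *)
Lemma multiplier_ge0 T : 0 <= \sum_(k < T) dotv (rbar k) (qbar k).
Proof.
pose q k := qof (w k) (z k); pose qs := qof ws zs.
pose dq i k := blk i (q k) - blk i qs.
pose dp i k := (blk i (z k) - blk i zs) - sigma m L i *: dq i k.
have qbE i k : blk i (qbar k) = rho ^- k *: dq i k.
  rewrite /qbar /wbar /zbar -scalemxAr -scalerBr blkZ /dq -blkB; congr (_ *: blk i _).
  by rewrite /q /qs /qof mulmxBr !opprD !opprK addrACA.
have pbE i k : blk i (pbar k) = rho ^- k *: dp i k.
  rewrite /pbar blkB blk_diagI qbE /zbar blkZ blkB /dp [in RHS]scalerBr !scalerA.
  by rewrite [sigma _ _ _ * _]mulrC.
have -> : \sum_(k < T) dotv (rbar k) (qbar k) = \sum_i \sum_(k < T)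
    \sum_(nu < nmax.+1) (if (nu <= k)%N then lam i nu * (rho ^- (k - nu) *
      (rho ^- k * dotv (dq i k) (dp i (k - nu)%N))) else 0).
  rewrite [RHS]exchange_big /=; apply: eq_bigr => k _.
  rewrite dotv_blk; apply: eq_bigr => i _.
  rewrite filter_output dotv_suml; apply: eq_bigr => nu _.
  rewrite dotvZl /delayed; case: leqP => _.
    by rewrite qbE pbE dotvZl dotvZr dotvC.
  by rewrite (_ : blk i 0 = 0) ?dotv0l ?mulr0 //; apply/colP => l; rewrite !mxE.
apply: sumr_ge0 => i _.
apply: (@weighted_supply_ge0 _ _ (lam i) rho rho_gt0 rho_lt1 (lam_sum i) _
  (fun k j => dotv (dq i k) (dp i j))
  (fun k => storage m L i (f i) (blk i zs) (blk i qs) (blk i (z k)) (blk i (q k)))).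
- by move=> nu; apply: lam_le0.
- by move=> k; apply: (storage_ge0 m_lt_L (fS i) (subgradient_fixed i) (subgradient i k)).
- by move=> k; apply: (storage_le m_lt_L (fS i) (subgradient_fixed i) (subgradient i k)).
- move=> k j; apply: (storage_diff m_lt_L (fS i)); exact: subgradient.
Qed.

Variables (M : 'M[R]_(n + s * (nmax * c))) (e : R).
Hypothesis Mpos : posdef M.
Hypothesis e_gt0 : 0 < e.
Hypothesis diss : forall x q,
  dotv (ssA (GPsi m L rho S lam) *m x + ssB (GPsi m L rho S lam) *m q)
    (M *m (ssA (GPsi m L rho S lam) *m x + ssB (GPsi m L rho S lam) *m q))
  + dotv (ssC (GPsi m L rho S lam) *m x + ssD (GPsi m L rho S lam) *m q) q
  + e * (dotv x x + dotv q q) <= dotv x (M *m x).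

Lemma energy_bound k :
  e * (dotv (xhat k) (xhat k) + dotv (qbar k) (qbar k)) <=
  dotv (xhat 0) (M *m xhat 0).
Proof.
apply: (@dissipation_bound R (fun k => dotv (xhat k) (M *m xhat k))
  (fun k => dotv (rbar k) (qbar k))
  (fun k => e * (dotv (xhat k) (xhat k) + dotv (qbar k) (qbar k)))).
- by move=> T; rewrite xhatS rbarE; exact: diss.
- move=> T; have [->|v0] := eqVneq (xhat T) 0; first by rewrite dotv0l.
  exact/ltW/Mpos.2.
- by move=> T; rewrite mulr_ge0 ?(ltW e_gt0) // addr_ge0 ?dotvv_ge0.
- exact: multiplier_ge0.
Qed.

End Trajectory.
End ExponentialBound.

(** The constant depends on the system and on the certificate [M], [lam] only,
    hence is uniform over the class of nonlinearities. *)
Lemma exponential_bound (R : realType) (s c n nmax : nat) (m : 'I_s -> R)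
    (L : 'I_s -> \bar R) (rho : R) (S : ss R n (s * c) (s * c)) :
  (forall i, ((m i)%:E < L i)%E) -> 0 < rho -> rho < 1 ->
  robust_stability nmax m L rho S ->
  exists2 gamma : R, 0 < gamma & forall f : 'I_s -> 'cV[R]_c -> \bar R,
    (forall i, Sclass (m i) (L i) (f i)) ->
    let F : operator R (s * c) :=
      fun z => [set w | forall i, subdiff (m i) (f i) (blk i z) (blk i w)] in
    forall xs ws zs, fixed_point F S xs ws zs ->
    forall x w z, trajectory F S x w z -> forall k,
      Num.max (norm2 (x k - xs))
        (Num.max (norm2 (w k - ws)) (norm2 (z k - zs)))
      <= gamma * rho ^+ k * norm2 (x 0%N - xs).
Proof.
move=> m_lt_L rho_gt0 rho_lt1 [mD_unit [M [lam [Mpos LMI lam_sum lam_le0]]]].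
have [e e0 diss] := LMI_dissipation LMI.
have [CM CM0 CMP] := norm2_mulmx M.
have [CC CC0 CCP] := norm2_mulmx (ssC S).
have [CD CD0 CDP] := norm2_mulmx (ssD S).
have [Cm Cm0 CmP] := norm2_mulmx (diagI c m).
have [CJ CJ0 CJP] := norm2_mulmx (invmx (1%:M - diagI c m *m ssD S)).
pose g := Num.sqrt (CM / e); have g0 : 0 <= g by exact: sqrtr_ge0.
have g2 : g ^+ 2 = CM / e by rewrite sqr_sqrtr // divr_ge0 // ltW.
pose gw := CJ * (g + Cm * (CC * g)).
have gw0 : 0 <= gw by rewrite mulr_ge0 // addr_ge0 // mulr_ge0 // mulr_ge0.
pose gz := CC * g + CD * gw.
have gz0 : 0 <= gz by rewrite addr_ge0 // mulr_ge0.
exists (1 + g + gw + gz); first by rewrite !ltr_pwDl // -addrA ltr_pwDl.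
move=> f fS F xs ws zs fixed x w z traj k.
pose xb := xbar rho xs x k; pose wb := wbar rho ws w k.
pose zb := zbar rho zs z k; pose qb := qbar m rho ws zs w z k.
set x0 := norm2 (x 0%N - xs); have x00 : 0 <= x0 by exact: norm2_ge0.
have hx0 : norm2 (@xhat R s c n nmax m L rho xs ws zs x w z 0) = x0.
  rewrite norm2E dotv_col filter_state0 dotv0l addr0.
  by rewrite /xbar expr0 invr1 scale1r.
have bound := energy_bound m_lt_L rho_gt0 rho_lt1 mD_unit lam_sum lam_le0 fS
  fixed traj Mpos e0 diss k.
have {}bound : dotv xb xb + dotv qb qb <= g ^+ 2 * x0 ^+ 2.
  have : e * (dotv xb xb + dotv qb qb) <= CM * x0 ^+ 2.
    apply: le_trans (_ : _ <= _) (le_trans bound _).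
      rewrite ler_pM2l // lerD2r dotv_col lerDl; exact: dotvv_ge0.
    apply: le_trans (CauchySchwarz _ _) _.
    by rewrite hx0 expr2 mulrCA ler_wpM2l // -hx0 CMP.
  by rewrite g2 mulrAC ler_pdivlMr // mulrC.
have xbP : norm2 xb <= g * x0.
  rewrite -(@ler_pXn2r _ 2) ?nnegrE ?mulr_ge0 ?norm2_ge0 //.
  by rewrite norm2_sqr exprMn; apply: le_trans bound; rewrite lerDl dotvv_ge0.
have qbP : norm2 qb <= g * x0.
  rewrite -(@ler_pXn2r _ 2) ?nnegrE ?mulr_ge0 ?norm2_ge0 //.
  by rewrite norm2_sqr exprMn; apply: le_trans bound; rewrite lerDr dotvv_ge0.
have zbE : zb = ssC S *m xb + ssD S *m wb := zbarE rho fixed traj k.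
have [_ _ wbE] := SigmaG_step L rho mD_unit zbE.
have wbP : norm2 wb <= gw * x0.
  rewrite wbE /gw -mulrA; apply: le_trans (CJP _) _; rewrite ler_wpM2l //.
  apply: le_trans (norm2D _ _) _; rewrite mulrDl lerD //.
  apply: le_trans (CmP _) _; rewrite -mulrA ler_wpM2l //.
  by apply: le_trans (CCP _) _; rewrite -mulrA ler_wpM2l.
have zbP : norm2 zb <= gz * x0.
  rewrite zbE /gz mulrDl -(mulrA CC) -(mulrA CD).
  apply: le_trans (norm2D _ _) _; rewrite lerD //.
    by apply: le_trans (CCP _) _; rewrite ler_wpM2l.
  by apply: le_trans (CDP _) _; rewrite ler_wpM2l.
have unscale p (v vs : 'cV[R]_p) C : C <= 1 + g + gw + gz ->
    norm2 (rho ^- k *: (v - vs)) <= C * x0 ->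
    norm2 (v - vs) <= (1 + g + gw + gz) * rho ^+ k * x0.
  move=> Cle; rewrite norm2Z ger0_norm ?invr_ge0 ?exprn_ge0 ?(ltW rho_gt0) //.
  rewrite mulrC ler_pdivrMr ?exprn_gt0 // => h; apply: le_trans h _.
  by rewrite mulrAC ler_wpM2r // ler_wpM2r // exprn_ge0 // ltW.
rewrite !ge_max; apply/andP; split; last (apply/andP; split).
- by apply: unscale xbP; lra.
- by apply: unscale wbP; lra.
- by apply: unscale zbP; lra.
Qed.

(** * The equilibrium *)

(** The elimination of [u] and [y]: any solution of the loop equations is the
    one given by the closed-loop matrices. *)
Lemma PK_loop (R : realType) (n p nu ny nc : nat) (P : network R n p nu ny)
    (K : ss R nc ny nu) (x : 'cV[R]_n) (xi : 'cV[R]_nc) (w : 'cV[R]_p)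
    (u : 'cV[R]_nu) (y : 'cV[R]_ny) :
  PK_well_posed P K ->
  y = nC2 P *m x + nD21 P *m w + nD2 P *m u ->
  u = ssC K *m xi + ssD K *m y ->
  ssA (PK P K) *m col_mx x xi + ssB (PK P K) *m w =
    col_mx (nA P *m x + nB1 P *m w + nB2 P *m u) (ssA K *m xi + ssB K *m y) /\
  ssC (PK P K) *m col_mx x xi + ssD (PK P K) *m w =
    nC1 P *m x + nD1 P *m w + nD12 P *m u.
Proof.
move=> wp yE uE.
rewrite /PK /=; set J := invmx _; set yx := row_mx (J *m _) _.
set yw := J *m nD21 P; set ux := row_mx 0 _ + _.
have yE' : y = yx *m col_mx x xi + yw *m w.
  have : (1%:M - nD2 P *m ssD K) *m y =
      nC2 P *m x + nD2 P *m ssC K *m xi + nD21 P *m w.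
    rewrite mulmxBl mul1mx {1}yE {1}uE mulmxDr !mulmxA.
    by rewrite addrA addrK addrAC.
  move=> /(congr1 (mulmx J)); rewrite mulKmx // => ->.
  by rewrite /yx /yw mul_row_col !mulmxDr !mulmxA.
have uE' : u = ux *m col_mx x xi + ssD K *m yw *m w.
  rewrite {1}uE {1}yE' /ux (mulmxDl (row_mx 0 _)).
  by rewrite (mul_row_col 0) mul0mx add0r mulmxDr !mulmxA addrA.
clearbody J yx yw ux; split.
- rewrite mul_col_mx mul_col_mx add_col_mx; congr col_mx.
    rewrite !mulmxDl mul_row_col mul0mx addr0 [in RHS]uE' !mulmxDr !mulmxA.
    by rewrite -!addrA; congr (_ + _); rewrite addrCA.
  rewrite !mulmxDl mul_row_col mul0mx add0r [in RHS]yE' !mulmxDr !mulmxA.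
  by rewrite addrA.
- rewrite !mulmxDl mul_row_col mul0mx addr0 [in RHS]uE' !mulmxDr !mulmxA.
  by rewrite -!addrA; congr (_ + _); rewrite addrCA.
Qed.

(** The regulator equations parametrise, linearly in [(- beta, v)], equilibria
    of the linear part with output [beta] in every block and input [N v]. *)
Lemma regulator_equilibrium (R : realType) (s c n nu ny nc : nat)
    (N : 'M[R]_(s * c, s.-1 * c)) (P : network R n (s * c) nu ny)
    (K : ss R nc ny nu) (beta : 'cV[R]_c) (v : 'cV[R]_(s.-1 * c)) :
  PK_well_posed P K -> regulator_equations N P K ->
  exists xs, xs = ssA (PK P K) *m xs + ssB (PK P K) *m (N *m v) /\
    onesI R s c *m beta = ssC (PK P K) *m xs + ssD (PK P K) *m (N *m v).
Proof.
move=> wp [X [Y [Gam [Phi [E1 E2 E3 E4 E5]]]]].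
pose eta := col_mx (- beta) v.
have yE : Phi *m eta = nC2 P *m (X *m eta) + nD21 P *m (N *m v) + nD2 P *m (Gam *m eta).
  by rewrite -{1}E3 !mulmxDl mul_row_col mul0mx add0r !mulmxA.
have uE : Gam *m eta = ssC K *m (Y *m eta) + ssD K *m (Phi *m eta).
  by rewrite -{1}E5 !mulmxDl !mulmxA.
have [h1 h2] := PK_loop wp yE uE.
exists (col_mx (X *m eta) (Y *m eta)); rewrite h1 h2; split.
  congr col_mx.
    by rewrite -{1}E1 !mulmxDl mul_row_col mul0mx add0r !mulmxA.
  by rewrite -{1}E4 !mulmxDl !mulmxA.
have : (nC1 P *m X + row_mx (onesI R s c) (nD1 P *m N) + nD12 P *m Gam) *m eta = 0.
  by rewrite E2 mul0mx.
rewrite !mulmxDl mul_row_col mulmxN -!mulmxA => /eqP h.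
apply/eqP; rewrite eq_sym -subr_eq0 -(eqP h); apply/eqP.
by rewrite addrAC; congr (_ + _); rewrite -addrA; congr (_ + _); rewrite addrC.
Qed.

Lemma cvg_geometric_bound (R : realType) (n : nat) (x : nat -> 'cV[R]_n)
    (xs : 'cV[R]_n) (rho C : R) : 0 < rho -> rho < 1 ->
  (forall k, norm2 (x k - xs) <= C * rho ^+ k) -> x @ \oo --> xs.
Proof.
move=> rho0 rho1 h; apply/(@cvgrPdist_lt _ _ _ \oo _ x xs) => e e0.
have : (fun k => C * rho ^+ k) @ \oo --> C * 0.
  apply: cvgM; first exact: cvg_cst.
  by apply: cvg_expr; rewrite gtr0_norm.
rewrite mulr0 => /cvgrPdist_lt/(_ e e0); apply: filterS => k.
rewrite sub0r normrN => hk; rewrite distrC.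
apply: le_lt_trans (mx_norm_le_norm2 _) _.
by apply: le_lt_trans (h k) (le_lt_trans (ler_norm _) hk).
Qed.

(** * Well-posedness and exponential convergence *)

(** At zero state the dissipation inequality bounds the feedthrough of the
    filtered interconnection; that is all [loop_well_posed] asks for. *)
Lemma robust_stability_well_posed (R : realType) (s c n nmax : nat)
    (m : 'I_s -> R) (L : 'I_s -> \bar R) (rho : R)
    (S : ss R n (s * c) (s * c)) (f : 'I_s -> 'cV[R]_c -> \bar R) :
  (forall i, ((m i)%:E < L i)%E) -> 0 < rho ->
  robust_stability nmax m L rho S -> (forall i, Sclass (m i) (L i) (f i)) ->
  well_posed (fun z => [set w | forall i,
    subdiff (m i) (f i) (blk i z) (blk i w)]) S.
Proof.
move=> m_lt_L rho_gt0 [mD_unit [M [lam [Mpos LMI lam_sum lam_le0]]]] fS.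
have [e e0 diss] := LMI_dissipation LMI.
apply: (loop_well_posed m_lt_L (lam := fun i => lam i ord0) mD_unit _ e0 _ fS).
  by move=> i; apply: (lam0_gt0 rho_gt0 (lam_sum i)) => nu; apply: lam_le0.
move=> v; have := diss 0 v.
rewrite !mulmx0 !add0r !dotv0l add0r mulNmx dotvNr => h.
change (e * dotv v v <= - dotv v (ssD (GPsi m L rho S lam) *m v)).
rewrite (dotvC v).
set B := ssB _ in h; have : 0 <= dotv (B *m v) (M *m (B *m v)).
  have [->|v0] := eqVneq (B *m v) 0; first by rewrite dotv0l.
  exact/ltW/Mpos.2.
by lra.
Qed.

Theorem theorem6p3 (R : realType) (s c n nu ny nc nmax : nat)
    (s_gt0 : (0 < s)%N) (c_gt0 : (0 < c)%N)
    (m : 'I_s -> R) (L : 'I_s -> \bar R)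
    (m_lt_L : forall i, ((m i)%:E < L i)%E)
    (sum_m_gt0 : 0 < \sum_i m i)
    (N : 'M[R]_(s * c, s.-1 * c)) (N_consensus : consensus_matrix N)
    (P : network R n (s * c) nu ny)
    (A1 : assumption1 m P) (A2 : assumption2 m P)
    (A3 : assumption3 P) (A4 : assumption4 m N P)
    (K : ss R nc ny nu) (PK_wp : PK_well_posed P K)
    (rho : R) (rho_gt0 : 0 < rho) (rho_lt1 : rho < 1)
    (information_constraint : block_lower_triangular (ssD (PK P K)))
    (regulator : regulator_equations N P K)
    (stability : robust_stability nmax m L rho (PK P K)) :
  (forall F : operator R (s * c), Oclass m L F -> well_posed F (PK P K)) /\
  exp_convergent (Oclass m L) (PK P K) rho.
Proof.
split=> [F [f [fS -> _]]|].
  exact: robust_stability_well_posed m_lt_L rho_gt0 stability fS.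
have [gamma gamma0 bound] := exponential_bound m_lt_L rho_gt0 rho_lt1 stability.
split; last first.
  exists gamma => // F [f [fS -> _]] xs ws zs [fixed _ _ _] x w z traj k.
  exact: bound fS _ _ _ fixed _ _ _ traj k.
move=> F [f [fS -> [[beta ws] [[/= ws0 wsf] _]]]].
have ones_ws : (onesI R s c)^T *m ws = 0 by rewrite tr_onesI_mul.
have [v wsE] := (N_consensus.2 ws).2 ones_ws.
have [xs [xsE zsE]] := regulator_equilibrium beta v PK_wp regulator.
rewrite -wsE in xsE zsE.
have fixed : fixed_point (fun z => [set w | forall i,
    subdiff (m i) (f i) (blk i z) (blk i w)]) (PK P K) xs ws (onesI R s c *m beta).
  by split => // i; rewrite blk_onesI.
exists xs, ws, (onesI R s c *m beta); split => //; first by exists beta.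
move=> x w z traj; have h := bound f fS _ _ _ fixed _ _ _ traj.
set C := gamma * norm2 (x 0%N - xs).
have {}h k : Num.max (norm2 (x k - xs)) (Num.max (norm2 (w k - ws))
    (norm2 (z k - onesI R s c *m beta))) <= C * rho ^+ k.
  by rewrite /C mulrAC; apply: h.
by split; apply: (cvg_geometric_bound rho_gt0 rho_lt1 (C := C)) => k;
  have := h k; rewrite !ge_max => /and3P[].
Qed.
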